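(* Let $\Sigma\subset\mathbb{R}^3$ be a connected RT-surface. Then $\Sigma$ is a surface of rotation if and only if there are constants $a,b\in\mathbb{R}$ such that $\Sigma$ can be locally parameterized by $$X_{a,b}(u_1,u_2)=\frac{e^{au_1+b}}{1+e^{2u_1}}\bigl(M(u_1)\cos(u_2),\,M(u_1)\sin(u_2),\,N(u_1)\bigr),$$ where $$M(u_1)=\frac{a(e^{-u_1}-e^{3u_1})+4e^{u_1}}{2},\qquad N(u_1)=1-e^{2u_1}-a(1+e^{2u_1}).$$
   Context: For an oriented surface $\Sigma\subset\mathbb{R}^3$ with unit normal (Gauss map) $\mathcal{N}$, the support function is $\Psi(p)=\langle p,\mathcal{N}(p)\rangle$ and the quadratic distance function is $\Lambda(p)=\langle p,p\rangle$, where $\langle\,,\rangle$ is the Euclidean scalar product. For a local parameterization $X$ the Weingarten matrix $W=(W_{ij})$ is defined by $\mathcal{N}_{,i}=\sum_{j}W_{ij}X_{,j}$ (subscripts ${}_{,i}$ denote partial derivatives); the Gaussian curvature is $K=\det W$ and the mean curvature is $H=-\tfrac12\operatorname{tr}W$. A surface $\Sigma$ with $K\neq 0$ is a Ribaucour-type surface (RT-surface) if for each $p\in\Sigma$ the sphere with center $p+\left(\frac{H(p)}{K(p)}+\frac{\Psi(p)}{2}\right)\mathcal{N}(p)$ and (signed) radius $\frac{H(p)}{K(p)}+\frac{\Psi(p)}{2}$ passes through the origin; in this case $\Sigma$ satisfies $2\Psi H+(\Lambda+\Psi^2)K=0$ at every point. In the claim, $M$ and $N$ denote the real functions of $u_1$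 given there ($N$ is not the Gauss map).
   Formalization: The local parameterization by X_{a,b} is meant up to a rotation about the origin and only at points of Σ off the axis of rotation (e.g. the poles of a sphere centred at 0 are never reached by X_{a,b}); ''surface of rotation'' is understood locally, about an arbitrary line. *)

(* Defs.v *)
From Stdlib Require Import Reals.
From Coquelicot Require Import Coquelicot.
Open Scope R_scope.

(** R^3 is [R * R * R], with Coquelicot's product topology and its vector space
    operations [plus], [minus], [scal], [zero]. *)
Notation R3 := (R * R * R)%type.

Definition c1 (p : R3) : R := fst (fst p).
Definition c2 (p : R3) : R := snd (fst p).
Definition c3 (p : R3) : R := snd p.

Definition dot (p q : R3) : R := c1 p * c1 q + c2 p * c2 q + c3 p * c3 q.

Definition cross (p q : R3) : R3 :=
  (c2 p * c3 q - c3 p * c2 q,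
   c3 p * c1 q - c1 p * c3 q,
   c1 p * c2 q - c2 p * c1 q).

Definition D1 (X : R -> R -> R3) (s t : R) : R3 :=
  (Derive (fun z => c1 (X z t)) s,
   Derive (fun z => c2 (X z t)) s,
   Derive (fun z => c3 (X z t)) s).

Definition D2 (X : R -> R -> R3) (s t : R) : R3 :=
  (Derive (fun z => c1 (X s z)) t,
   Derive (fun z => c2 (X s z)) t,
   Derive (fun z => c3 (X s z)) t).

Definition smooth_on (U : R * R -> Prop) (X : R -> R -> R3) : Prop :=
  forall s t, U (s, t) -> forall n : nat,
    ex_diff_n (fun x y => c1 (X x y)) n s t /\
    ex_diff_n (fun x y => c2 (X x y)) n s t /\
    ex_diff_n (fun x y => c3 (X x y)) n s t.

(** [X], restricted to the open set [U] of the plane, is a smooth immersion and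
    a homeomorphism onto a relatively open subset of [S].  The last two
    conjuncts say this: [X] is injective on [U], and it sends the open subsets
    of [U] to relatively open subsets of [S]. *)
Definition local_parameterization
    (S : R3 -> Prop) (X : R -> R -> R3) (U : R * R -> Prop) : Prop :=
  open U /\
  smooth_on U X /\
  (forall s t, U (s, t) -> S (X s t)) /\
  (forall s t, U (s, t) -> cross (D1 X s t) (D2 X s t) <> zero) /\
  (forall s t s' t', U (s, t) -> U (s', t') -> X s t = X s' t' ->
     s = s' /\ t = t') /\
  (forall U' : R * R -> Prop, open U' -> (forall u, U' u -> U u) ->
     exists V : R3 -> Prop, open V /\
       forall p, (S p /\ V p) <-> (exists s t, U' (s, t) /\ X s t = p)).

Definition locally_parameterized_at
    (S : R3 -> Prop) (X : R -> R -> R3) (p : R3) : Prop :=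
  exists U, local_parameterization S X U /\
    exists s t, U (s, t) /\ X s t = p.

Definition regular_surface (S : R3 -> Prop) : Prop :=
  forall p, S p -> exists X, locally_parameterized_at S X p.

Definition connected_set (S : R3 -> Prop) : Prop :=
  forall A B : R3 -> Prop, open A -> open B ->
    (forall p, S p -> A p \/ B p) ->
    (exists p, S p /\ A p) -> (exists p, S p /\ B p) ->
    exists p, S p /\ A p /\ B p.

(** [nu] is a total function on R^3; only its values on [S] matter. *)
Definition gauss_map (S : R3 -> Prop) (nu : R3 -> R3) : Prop :=
  forall X U, local_parameterization S X U ->
    smooth_on U (fun s t => nu (X s t)) /\
    forall s t, U (s, t) ->
      dot (nu (X s t)) (nu (X s t)) = 1 /\
      dot (nu (X s t)) (D1 X s t) = 0 /\
      dot (nu (X s t)) (D2 X s t) = 0.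

Definition oriented_surface (S : R3 -> Prop) (nu : R3 -> R3) : Prop :=
  regular_surface S /\ gauss_map S nu.

Definition support (nu : R3 -> R3) (p : R3) : R := dot p (nu p).

Definition weingarten_matrix (nu : R3 -> R3) (X : R -> R -> R3) (s t : R)
    (w11 w12 w21 w22 : R) : Prop :=
  D1 (fun x y => nu (X x y)) s t
    = plus (scal w11 (D1 X s t)) (scal w12 (D2 X s t)) /\
  D2 (fun x y => nu (X x y)) s t
    = plus (scal w21 (D1 X s t)) (scal w22 (D2 X s t)).

(** [K] and [H] are the Gaussian and the mean curvature of [S] at [p]. *)
Definition curvatures (S : R3 -> Prop) (nu : R3 -> R3) (p : R3) (K H : R)
    : Prop :=
  exists X U s t w11 w12 w21 w22,
    local_parameterization S X U /\ U (s, t) /\ X s t = p /\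
    weingarten_matrix nu X s t w11 w12 w21 w22 /\
    K = w11 * w22 - w12 * w21 /\
    H = - (1 / 2) * (w11 + w22).

(** The radius [r] is signed. *)
Definition on_sphere (center : R3) (r : R) (q : R3) : Prop :=
  sqrt (dot (minus q center) (minus q center)) = Rabs r.

Definition RT_surface (S : R3 -> Prop) (nu : R3 -> R3) : Prop :=
  oriented_surface S nu /\
  forall p K H, S p -> curvatures S nu p K H ->
    K <> 0 /\
    let r := H / K + support nu p / 2 in
    on_sphere (plus p (scal r (nu p))) r zero.

Definition direct_orthonormal_frame (e1 e2 e3 : R3) : Prop :=
  dot e1 e1 = 1 /\ dot e2 e2 = 1 /\ dot e1 e2 = 0 /\ e3 = cross e1 e2.

(** The proper rigid motion of R^3 that sends the standard frame at the origin
    to the frame [(e1, e2, e3)] at [c].  For [c = zero] it is a rotation about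
    the origin. *)
Definition rigid_motion (c e1 e2 e3 : R3) (p : R3) : R3 :=
  plus c (plus (scal (c1 p) e1) (plus (scal (c2 p) e2) (scal (c3 p) e3))).

Definition on_line (c e : R3) (p : R3) : Prop :=
  exists t : R, p = plus c (scal t e).

(** [S] is obtained by rotating plane curves [s |-> (f s, 0, g s)] about an
    arbitrary line, the image of the third axis under a rigid motion.  This is
    a local notion, so a piece of a surface of rotation counts as one.  No
    smoothness or regularity of [f] and [g] is stated because it follows from
    [local_parameterization].  A surface of rotation may meet its axis (a round
    sphere does), but polar coordinates are singular there; this is why the
    points of the axis are set apart. *)
Definition surface_of_rotation (S : R3 -> Prop) : Prop :=
  exists c e1 e2 e3 : R3, direct_orthonormal_frame e1 e2 e3 /\
    forall p, S p -> ~ on_line c e3 p ->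
      exists f g : R -> R,
        locally_parameterized_at S
          (fun s t => rigid_motion c e1 e2 e3 (f s * cos t, f s * sin t, g s))
          p.

Definition Mfun (a u1 : R) : R :=
  (a * (exp (- u1) - exp (3 * u1)) + 4 * exp u1) / 2.

Definition Nfun (a u1 : R) : R :=
  1 - exp (2 * u1) - a * (1 + exp (2 * u1)).

Definition Xab (a b u1 u2 : R) : R3 :=
  scal (exp (a * u1 + b) / (1 + exp (2 * u1)))
    ((Mfun a u1 * cos u2, Mfun a u1 * sin u2, Nfun a u1) : R3).

(* Main.v *)
From Pilot Require Import Defs.
From Stdlib Require Import Reals.
From Coquelicot Require Import Coquelicot.
Open Scope R_scope.
From Stdlib Require Import Lra Psatz Classical FunctionalExtensionality.
(* [c1] denotes the first coordinate again, not the C^1 functions of [Reals]. *)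
Import Pilot.Defs.

(** For a rotation surface about an axis through the origin, let [u] be the
    Mercator latitude of the normal: the profile has the unit normal
    [(sech u, - tanh u)] in the half-plane of a meridian.  As [K <> 0], [u] is a
    local coordinate on the meridian, and the meridian is the envelope of its
    tangent lines, so it is determined by the support function as a function of
    [u].  In terms of the Gauss map the equation
    [2 Psi H + (Lambda + Psi ^ 2) K = 0] says that [ln |Psi|] is harmonic on the
    sphere; for a function of [u] alone, [u] being a conformal coordinate, this
    means that it is affine.  The curve with [Psi = exp (a u + b)] is the
    meridian of [Xab a b].

    Instead of second derivatives with respect to [u], the proof uses the slope
    [a] and the intercept [b] of this affine function as functions on the
    surface, given in terms of the point and of its normal.  The Frenet
    equations of the profile and the RT equation, which here reads
    [Lambda + Psi ^ 2 = Psi (m / kap + f / alpha)], show that both have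
    derivative zero along the meridian ([is_derive_slope],
    [is_derive_intercept]), and solving their definitions for the point gives
    [Xab a b] ([meridian_is_model]).

    Two global matters remain.  The axis passes through the origin
    ([RT_axis_through_origin]), because on a parallel the RT equation is a
    nontrivial quadratic equation for the projection of a point of the axis on
    the radial direction.  And [a], [b] are the same on the whole surface
    ([const_off_axis]), although they are defined only off the axis: the
    surface meets the axis in isolated points ([axis_points_isolated]), which do
    not disconnect it.

    Conversely, [Xab a b] is a rotation parameterization about the third axis,
    as it stands. *)

(** * Vectors and orthonormal frames *)

Lemma R3_ext (p q : R3) : c1 p = c1 q -> c2 p = c2 q -> c3 p = c3 q -> p = q.
Proof.
  destruct p as [[x y] z], q as [[x' y'] z']; unfold c1, c2, c3; simpl; congruence.
Qed.

Lemma c1_plus (p q : R3) : c1 (plus p q) = c1 p + c1 q. Proof. reflexivity. Qed.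
Lemma c2_plus (p q : R3) : c2 (plus p q) = c2 p + c2 q. Proof. reflexivity. Qed.
Lemma c3_plus (p q : R3) : c3 (plus p q) = c3 p + c3 q. Proof. reflexivity. Qed.
Lemma c1_minus (p q : R3) : c1 (minus p q) = c1 p - c1 q. Proof. reflexivity. Qed.
Lemma c2_minus (p q : R3) : c2 (minus p q) = c2 p - c2 q. Proof. reflexivity. Qed.
Lemma c3_minus (p q : R3) : c3 (minus p q) = c3 p - c3 q. Proof. reflexivity. Qed.
Lemma c1_scal (a : R) (q : R3) : c1 (scal a q) = a * c1 q. Proof. reflexivity. Qed.
Lemma c2_scal (a : R) (q : R3) : c2 (scal a q) = a * c2 q. Proof. reflexivity. Qed.
Lemma c3_scal (a : R) (q : R3) : c3 (scal a q) = a * c3 q. Proof. reflexivity. Qed.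
Lemma c1_zero : c1 zero = 0. Proof. reflexivity. Qed.
Lemma c2_zero : c2 zero = 0. Proof. reflexivity. Qed.
Lemma c3_zero : c3 zero = 0. Proof. reflexivity. Qed.
Lemma c1_tuple (x y z : R) : c1 (x, y, z) = x. Proof. reflexivity. Qed.
Lemma c2_tuple (x y z : R) : c2 (x, y, z) = y. Proof. reflexivity. Qed.
Lemma c3_tuple (x y z : R) : c3 (x, y, z) = z. Proof. reflexivity. Qed.

Ltac vec_simpl :=
  unfold dot, cross, rigid_motion, D1, D2;
  do 2 rewrite ?c1_tuple, ?c2_tuple, ?c3_tuple, ?c1_plus, ?c2_plus, ?c3_plus,
    ?c1_minus, ?c2_minus, ?c3_minus, ?c1_scal, ?c2_scal, ?c3_scal,
    ?c1_zero, ?c2_zero, ?c3_zero;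
  repeat match goal with
  | |- context [c1 (@zero ?G)] => change (c1 (@zero G)) with 0
  | |- context [c2 (@zero ?G)] => change (c2 (@zero G)) with 0
  | |- context [c3 (@zero ?G)] => change (c3 (@zero G)) with 0
  end.

Lemma cross_norm (p q : R3) :
  dot (cross p q) (cross p q) = dot p p * dot q q - dot p q ^ 2.
Proof. vec_simpl; ring. Qed.

Lemma dot_self_eq0 (p : R3) : dot p p = 0 -> p = zero.
Proof. intro h; unfold dot in h; apply R3_ext; vec_simpl; nra. Qed.

Lemma cross_neq0 (p q : R3) :
  cross p q <> zero <-> dot p p * dot q q - dot p q ^ 2 <> 0.
Proof.
  rewrite <- cross_norm; split; intros h e; apply h.
  - now apply dot_self_eq0.
  - rewrite e; vec_simpl; ring.
Qed.

Definition coords (e1 e2 e3 q : R3) : R3 := (dot q e1, dot q e2, dot q e3).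

Lemma frame_gram (e1 e2 e3 : R3) : direct_orthonormal_frame e1 e2 e3 ->
  dot e1 e1 = 1 /\ dot e2 e2 = 1 /\ dot e3 e3 = 1 /\
  dot e1 e2 = 0 /\ dot e1 e3 = 0 /\ dot e2 e3 = 0.
Proof.
  intros (h1 & h2 & h12 & ->); repeat split; trivial.
  - rewrite cross_norm, h1, h2, h12; ring.
  - vec_simpl; ring.
  - vec_simpl; ring.
Qed.

Lemma dot_frame (e1 e2 e3 : R3) : direct_orthonormal_frame e1 e2 e3 -> forall p q,
  dot (rigid_motion zero e1 e2 e3 p) (rigid_motion zero e1 e2 e3 q) = dot p q.
Proof.
  intros hf p q; destruct (frame_gram _ _ _ hf) as (h1 & h2 & h3 & h12 & h13 & h23).
  transitivity
    (c1 p * c1 q * dot e1 e1 + c2 p * c2 q * dot e2 e2 + c3 p * c3 q * dot e3 e3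
     + (c1 p * c2 q + c2 p * c1 q) * dot e1 e2
     + (c1 p * c3 q + c3 p * c1 q) * dot e1 e3
     + (c2 p * c3 q + c3 p * c2 q) * dot e2 e3).
  - vec_simpl; ring.
  - rewrite h1, h2, h3, h12, h13, h23; vec_simpl; ring.
Qed.

Lemma coords_frame (e1 e2 e3 : R3) : direct_orthonormal_frame e1 e2 e3 -> forall p,
  coords e1 e2 e3 (rigid_motion zero e1 e2 e3 p) = p.
Proof.
  intros hf p; destruct (frame_gram _ _ _ hf) as (h1 & h2 & h3 & h12 & h13 & h23).
  apply R3_ext; unfold coords; rewrite ?c1_tuple, ?c2_tuple, ?c3_tuple.
  - transitivity (c1 p * dot e1 e1 + c2 p * dot e1 e2 + c3 p * dot e1 e3);
      [vec_simpl; ring | rewrite h1, h12, h13; ring].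
  - transitivity (c1 p * dot e1 e2 + c2 p * dot e2 e2 + c3 p * dot e2 e3);
      [vec_simpl; ring | rewrite h2, h12, h23; ring].
  - transitivity (c1 p * dot e1 e3 + c2 p * dot e2 e3 + c3 p * dot e3 e3);
      [vec_simpl; ring | rewrite h3, h13, h23; ring].
Qed.

(** A vector orthogonal to the frame vanishes by Cramer's rule: the frame has
    determinant [|e1 x e2| ^ 2 = 1]. *)
Lemma frame_coords (e1 e2 e3 : R3) : direct_orthonormal_frame e1 e2 e3 -> forall q,
  rigid_motion zero e1 e2 e3 (coords e1 e2 e3 q) = q.
Proof.
  intros hf q.
  set (v := minus q (rigid_motion zero e1 e2 e3 (coords e1 e2 e3 q)) : R3).
  assert (hv : coords e1 e2 e3 v = zero).
  { pose proof (coords_frame _ _ _ hf (coords e1 e2 e3 q)) as hc.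
    assert (hm : coords e1 e2 e3 v
      = minus (coords e1 e2 e3 q)
          (coords e1 e2 e3 (rigid_motion zero e1 e2 e3 (coords e1 e2 e3 q)))).
    { unfold v; generalize (rigid_motion zero e1 e2 e3 (coords e1 e2 e3 q)).
      intro w; apply R3_ext; unfold coords; vec_simpl; ring. }
    rewrite hm, hc; apply R3_ext; vec_simpl; ring. }
  assert (d1 : dot v e1 = 0) by exact (f_equal c1 hv).
  assert (d2 : dot v e2 = 0) by exact (f_equal c2 hv).
  assert (d3 : dot v e3 = 0) by exact (f_equal c3 hv).
  assert (hdet : dot (cross e1 e2) (cross e1 e2) = 1).
  { destruct (frame_gram _ _ _ hf) as (_ & _ & h3 & _).
    destruct hf as (_ & _ & _ & <-); exact h3. }
  assert (hcr : scal (dot (cross e1 e2) (cross e1 e2)) v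
    = plus (scal (dot v e1) (cross e2 e3))
        (plus (scal (dot v e2) (cross e3 e1)) (scal (dot v e3) (cross e1 e2)))).
  { destruct hf as (_ & _ & _ & ->); apply R3_ext; vec_simpl; ring. }
  rewrite hdet, d1, d2, d3 in hcr.
  assert (hv0 : v = (zero : R3)).
  { generalize (f_equal c1 hcr) (f_equal c2 hcr) (f_equal c3 hcr).
    vec_simpl; intros; apply R3_ext; vec_simpl; lra. }
  generalize (f_equal c1 hv0) (f_equal c2 hv0) (f_equal c3 hv0).
  unfold v; rewrite ?c1_minus, ?c2_minus, ?c3_minus; vec_simpl.
  intros; apply R3_ext; vec_simpl; lra.
Qed.

Lemma rigid_motion_coords (c e1 e2 e3 : R3) : direct_orthonormal_frame e1 e2 e3 ->
  forall p, rigid_motion c e1 e2 e3 p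
    = rigid_motion zero e1 e2 e3 (plus (coords e1 e2 e3 c) p).
Proof.
  intros hf p; rewrite <- (frame_coords _ _ _ hf c) at 1.
  generalize (coords e1 e2 e3 c); intro w; apply R3_ext; vec_simpl; ring.
Qed.

Lemma dot_coords (e1 e2 e3 : R3) : direct_orthonormal_frame e1 e2 e3 -> forall p q,
  dot (coords e1 e2 e3 p) (coords e1 e2 e3 q) = dot p q.
Proof. intros hf p q; rewrite <- (dot_frame _ _ _ hf), !(frame_coords _ _ _ hf); trivial. Qed.

Lemma on_line_coords (c e1 e2 e3 : R3) : direct_orthonormal_frame e1 e2 e3 ->
  forall p, on_line c e3 p <-> dot (minus p c) e1 = 0 /\ dot (minus p c) e2 = 0.
Proof.
  intros hf p; destruct (frame_gram _ _ _ hf) as (_ & _ & _ & _ & h13 & h23); split.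
  - intros [t ->]; split.
    + transitivity (t * dot e1 e3); [vec_simpl; ring | rewrite h13; ring].
    + transitivity (t * dot e2 e3); [vec_simpl; ring | rewrite h23; ring].
  - intros [h1 h2]; exists (dot (minus p c) e3).
    pose proof (frame_coords _ _ _ hf (minus p c)) as h.
    unfold coords in h; rewrite h1, h2 in h.
    generalize (f_equal c1 h) (f_equal c2 h) (f_equal c3 h).
    rewrite ?c1_minus, ?c2_minus, ?c3_minus; unfold rigid_motion.
    intros; apply R3_ext; revert H H0 H1; generalize (dot (minus p c) e3); intro;
      vec_simpl; lra.
Qed.

(** * Calculus of one and of two variables *)

Lemma open_locally_2d (U : R * R -> Prop) : open U ->
  forall s t, U (s, t) -> locally_2d (fun s t => U (s, t)) s t.
Proof.
  intros hU s t h; apply locally_2d_locally.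
  generalize (hU _ h); apply filter_imp; intros [a b]; trivial.
Qed.

Lemma locally_2d_open (U : R * R -> Prop) :
  (forall s t, U (s, t) -> locally_2d (fun s t => U (s, t)) s t) -> open U.
Proof.
  intros hU [s t] h; generalize (proj1 (locally_2d_locally _ _ _) (hU s t h)).
  apply filter_imp; intros [a b]; trivial.
Qed.

Lemma open_box (s0 t0 d : R) :
  open (fun q : R * R => Rabs (fst q - s0) < d /\ Rabs (snd q - t0) < d).
Proof.
  apply locally_2d_open; simpl; intros s t [hs ht].
  assert (hm : 0 < Rmin (d - Rabs (s - s0)) (d - Rabs (t - t0))).
  { apply Rmin_pos; lra. }
  exists (mkposreal _ hm); simpl; intros u v hu hv.
  pose proof (Rmin_l (d - Rabs (s - s0)) (d - Rabs (t - t0))).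
  pose proof (Rmin_r (d - Rabs (s - s0)) (d - Rabs (t - t0))).
  pose proof (Rabs_triang (u - s) (s - s0)).
  pose proof (Rabs_triang (v - t) (t - t0)).
  replace (u - s0) with (u - s + (s - s0)) by ring.
  replace (v - t0) with (v - t + (t - t0)) by ring.
  lra.
Qed.

Lemma const_of_is_derive_0 (f : R -> R) (a d : R) :
  (forall x, Rabs (x - a) < d -> is_derive f x 0) ->
  forall x, Rabs (x - a) < d -> f x = f a.
Proof.
  intros h x hx; apply Rabs_def2 in hx.
  destruct (total_order_T x a) as [[lt | ->] | gt]; trivial.
  - apply (eq_is_derive (V := R_NormedModule) f x a); trivial.
    intros; apply h, Rabs_def1; lra.
  - symmetry; apply (eq_is_derive (V := R_NormedModule) f a x); trivial.
    intros; apply h, Rabs_def1; lra.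
Qed.

Lemma const_of_locally_const (f : R -> R) (a b : R) :
  (forall x, Rmin a b <= x <= Rmax a b -> locally x (fun y => f y = f x)) ->
  f a = f b.
Proof.
  assert (main : forall a b, a < b ->
    (forall x, a <= x <= b -> locally x (fun y => f y = f x)) -> f a = f b).
  { clear a b; intros a b lt h.
    apply (eq_is_derive (V := R_NormedModule) f a b); trivial.
    intros t ht; apply (is_derive_ext_loc (fun _ => f t)).
    - generalize (h t ht); apply filter_imp; auto.
    - apply (is_derive_const (f t)). }
  intro h; destruct (total_order_T a b) as [[lt | ->] | gt]; trivial.
  - apply main; trivial; intros x hx; apply h.
    rewrite Rmin_left, Rmax_right; lra.
  - symmetry; apply main; trivial; intros x hx; apply h.
    rewrite Rmin_right, Rmax_left; lra.
Qed.

Lemma is_derive_increasing_at (f : R -> R) (x l : R) : is_derive f x l -> 0 < l ->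
  exists d, 0 < d /\ forall h, 0 < h < d -> f (x - h) < f x < f (x + h).
Proof.
  intros hd hl; apply is_derive_Reals in hd.
  destruct (hd l hl) as [d hdl]; exists d; split; [apply cond_pos |].
  assert (key : forall h, h <> 0 -> Rabs h < d -> 0 < (f (x + h) - f x) * h).
  { intros h h0 hh; specialize (hdl h h0 hh); apply Rabs_def2 in hdl.
    replace ((f (x + h) - f x) * h) with ((f (x + h) - f x) / h * (h * h))
      by (field; trivial).
    apply Rmult_lt_0_compat; [lra | nra]. }
  intros h [h0 hh]; split.
  - specialize (key (- h) ltac:(lra)); rewrite Rabs_Ropp, Rabs_right in key by lra.
    specialize (key hh); unfold Rminus; nra.
  - specialize (key h ltac:(lra)); rewrite Rabs_right in key by lra.
    specialize (key hh); nra.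
Qed.

(** The derivative at the single point [x] separates [f x] from the values at
    the two sides; the intermediate value theorem then fills a neighbourhood. *)
Lemma open_map_of_is_derive (f : R -> R) (x l d : R) : 0 < d -> l <> 0 ->
  is_derive f x l -> (forall y, Rabs (y - x) < d -> continuity_pt f y) ->
  exists eta, 0 < eta /\
    forall v, Rabs (v - f x) < eta -> exists y, Rabs (y - x) < d /\ f y = v.
Proof.
  assert (main : forall f l, 0 < d -> 0 < l ->
    is_derive f x l -> (forall y, Rabs (y - x) < d -> continuity_pt f y) ->
    exists eta, 0 < eta /\
      forall v, Rabs (v - f x) < eta -> exists y, Rabs (y - x) < d /\ f y = v).
  { clear f l; intros f l hd hl hf hc.
    destruct (is_derive_increasing_at f x l hf hl) as (d' & hd' & inc).
    set (h := Rmin d d' / 2).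
    pose proof (Rmin_l d d'); pose proof (Rmin_r d d').
    assert (0 < Rmin d d') by now apply Rmin_pos.
    destruct (inc h ltac:(unfold h; lra)) as [lo hi].
    exists (Rmin (f x - f (x - h)) (f (x + h) - f x)); split; [apply Rmin_pos; lra |].
    intros v hv.
    pose proof (Rmin_l (f x - f (x - h)) (f (x + h) - f x)).
    pose proof (Rmin_r (f x - f (x - h)) (f (x + h) - f x)).
    apply Rabs_def2 in hv.
    destruct (Ranalysis5.IVT_interv (fun y => f y - v) (x - h) (x + h)) as (y & hy & e).
    - intros y hy; apply continuity_pt_minus.
      + apply hc, Rabs_def1; unfold h in hy; lra.
      + apply continuity_pt_const; intros ? ?; trivial.
    - unfold h; lra.
    - lra.
    - lra.
    - exists y; split; [apply Rabs_def1; unfold h in hy |]; lra. }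
  intros hd hl hf hc; destruct (Rlt_dec 0 l) as [pos | neg]; [now apply (main f l) |].
  destruct (main (fun y => - f y) (- l)) as (eta & he & hv); trivial.
  - lra.
  - now apply (is_derive_opp f).
  - intros y hy; now apply continuity_pt_opp, hc.
  - exists eta; split; trivial; intros v h.
    destruct (hv (- v)) as (y & hy & e).
    + replace (- v - - f x) with (- (v - f x)) by ring; now rewrite Rabs_Ropp.
    + exists y; split; trivial; lra.
Qed.

Lemma continuity_2d_pt_fst (f : R -> R) (x y : R) :
  continuity_pt f x -> continuity_2d_pt (fun u _ => f u) x y.
Proof.
  intro h; apply (continuity_1d_2d_pt_comp f (fun u _ => u)); trivial.
  apply continuity_2d_pt_id1.
Qed.

Lemma continuity_2d_pt_snd (f : R -> R) (x y : R) :
  continuity_pt f y -> continuity_2d_pt (fun _ v => f v) x y.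
Proof.
  intro h; apply (continuity_1d_2d_pt_comp f (fun _ v => v)); trivial.
  apply continuity_2d_pt_id2.
Qed.

(** Terms for the functions of two variables generated by constants,
    exponentials of the first variable, sine and cosine of the second one, and
    the logistic factor of [Xab].  This class is closed under both partial
    derivatives, which proves smoothness by induction on the order. *)
Inductive term : Type :=
  | Cst (c : R) | Exp (c : R) | Logistic | Cos | Sin
  | Add (p q : term) | Mul (p q : term).

Fixpoint eval (e : term) (u v : R) : R :=
  match e with
  | Cst c => c
  | Exp c => exp (c * u)
  | Logistic => / (1 + exp (2 * u))
  | Cos => cos v
  | Sin => sin v
  | Add p q => eval p u v + eval q u v
  | Mul p q => eval p u v * eval q u v
  end.

Fixpoint partial1 (e : term) : term :=
  match e with
  | Exp c => Mul (Cst c) (Exp c)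
  | Logistic => Mul (Cst (- 2)) (Mul (Exp 2) (Mul Logistic Logistic))
  | Add p q => Add (partial1 p) (partial1 q)
  | Mul p q => Add (Mul (partial1 p) q) (Mul p (partial1 q))
  | _ => Cst 0
  end.

Fixpoint partial2 (e : term) : term :=
  match e with
  | Cos => Mul (Cst (- 1)) Sin
  | Sin => Cos
  | Add p q => Add (partial2 p) (partial2 q)
  | Mul p q => Add (Mul (partial2 p) q) (Mul p (partial2 q))
  | _ => Cst 0
  end.

Lemma logistic_denominator (u : R) : 1 + exp (2 * u) <> 0.
Proof. pose proof (exp_pos (2 * u)); lra. Qed.

Lemma is_derive_partial1 (e : term) (u v : R) :
  is_derive (fun z => eval e z v) u (eval (partial1 e) u v).
Proof.
  induction e as [c | c | | | | p IHp q IHq | p IHp q IHq]; simpl;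
    try exact (is_derive_const (V := R_NormedModule) _ _).
  - auto_derive; trivial; ring.
  - pose proof (logistic_denominator u); auto_derive; trivial; field; trivial.
  - now apply (is_derive_plus (fun z => eval p z v) (fun z => eval q z v)).
  - apply (is_derive_mult (fun z => eval p z v) (fun z => eval q z v)); trivial.
    exact Rmult_comm.
Qed.

Lemma is_derive_partial2 (e : term) (u v : R) :
  is_derive (fun z => eval e u z) v (eval (partial2 e) u v).
Proof.
  induction e as [c | c | | | | p IHp q IHq | p IHp q IHq]; simpl;
    try exact (is_derive_const (V := R_NormedModule) _ _).
  - auto_derive; trivial; ring.
  - auto_derive; trivial; ring.
  - now apply (is_derive_plus (fun z => eval p u z) (fun z => eval q u z)).
  - apply (is_derive_mult (fun z => eval p u z) (fun z => eval q u z)); trivial.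
    exact Rmult_comm.
Qed.

Lemma continuity_2d_pt_eval (e : term) (u v : R) : continuity_2d_pt (eval e) u v.
Proof.
  induction e as [c | c | | | | p IHp q IHq | p IHp q IHq]; simpl.
  - apply continuity_2d_pt_const.
  - apply (continuity_2d_pt_fst (fun u => exp (c * u))).
    apply derivable_continuous_pt, ex_derive_Reals_0; auto_derive; trivial.
  - apply (continuity_2d_pt_fst (fun u => / (1 + exp (2 * u)))).
    apply derivable_continuous_pt, ex_derive_Reals_0; auto_derive.
    apply logistic_denominator.
  - apply (continuity_2d_pt_snd cos), derivable_continuous_pt, derivable_pt_cos.
  - apply (continuity_2d_pt_snd sin), derivable_continuous_pt, derivable_pt_sin.
  - now apply continuity_2d_pt_plus.
  - now apply continuity_2d_pt_mult.
Qed.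

Lemma ex_diff_n_eval (n : nat) : forall (e : term) (u v : R), ex_diff_n (eval e) n u v.
Proof.
  induction n as [| n IHn]; intros e u v; simpl;
    (split; [apply continuity_2d_pt_eval |]); trivial.
  split; [eexists; apply is_derive_partial1 |].
  split; [eexists; apply is_derive_partial2 |].
  split.
  - apply ex_diff_n_ext_loc with (2 := IHn (partial1 e) u v).
    apply locally_2d_forall; intros; symmetry; apply is_derive_unique, is_derive_partial1.
  - apply ex_diff_n_ext_loc with (2 := IHn (partial2 e) u v).
    apply locally_2d_forall; intros; symmetry; apply is_derive_unique, is_derive_partial2.
Qed.

(** * Differentiation of curves in space *)

Lemma der_eq (f : R -> R) (s l l' : R) : is_derive f s l -> l = l' -> is_derive f s l'.
Proof. now intros h <-. Qed.

Lemma der_const (a s : R) : is_derive (fun _ : R => a) s 0.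
Proof. exact (is_derive_const (V := R_NormedModule) a s). Qed.

Lemma der_plus (f g : R -> R) (s a b : R) :
  is_derive f s a -> is_derive g s b -> is_derive (fun z => f z + g z) s (a + b).
Proof. exact (is_derive_plus (V := R_NormedModule) f g s a b). Qed.

Lemma der_minus (f g : R -> R) (s a b : R) :
  is_derive f s a -> is_derive g s b -> is_derive (fun z => f z - g z) s (a - b).
Proof. exact (is_derive_minus (V := R_NormedModule) f g s a b). Qed.

Lemma der_mult (f g : R -> R) (s a b : R) :
  is_derive f s a -> is_derive g s b -> is_derive (fun z => f z * g z) s (a * g s + f s * b).
Proof. intros h k; exact (is_derive_mult (K := R_AbsRing) f g s a b h k Rmult_comm). Qed.

Lemma der_cos (s : R) : is_derive cos s (- sin s).
Proof. auto_derive; trivial; ring. Qed.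

Lemma der_sin (s : R) : is_derive sin s (cos s).
Proof. auto_derive; trivial; ring. Qed.

(** Differentiates a polynomial expression in functions whose derivatives are
    among the hypotheses. *)
Ltac der_step :=
  lazymatch goal with
  | |- is_derive (fun _ => ?a) _ _ => apply der_const
  | |- is_derive (fun z => _ + _) _ _ => apply der_plus
  | |- is_derive (fun z => _ - _) _ _ => apply der_minus
  | |- is_derive (fun z => _ * _) _ _ => apply der_mult
  | |- is_derive (fun z => cos z) _ _ => apply der_cos
  | |- is_derive (fun z => sin z) _ _ => apply der_sin
  | |- is_derive cos _ _ => apply der_cos
  | |- is_derive sin _ _ => apply der_sin
  | |- is_derive _ _ _ => eassumption
  end.

Ltac der := eapply der_eq; [repeat der_step | cbv beta].

(** Componentwise, to match the definitions of [D1] and [D2]. *)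
Definition is_derive3 (gam : R -> R3) (s : R) (v : R3) : Prop :=
  is_derive (fun z => c1 (gam z)) s (c1 v) /\
  is_derive (fun z => c2 (gam z)) s (c2 v) /\
  is_derive (fun z => c3 (gam z)) s (c3 v).

Lemma is_derive3_D1 (X : R -> R -> R3) (s t : R) (v : R3) :
  is_derive3 (fun z => X z t) s v -> D1 X s t = v.
Proof.
  intros (h1 & h2 & h3); apply R3_ext; unfold D1;
    rewrite ?c1_tuple, ?c2_tuple, ?c3_tuple; now apply is_derive_unique.
Qed.

Lemma is_derive3_D2 (X : R -> R -> R3) (s t : R) (v : R3) :
  is_derive3 (fun z => X s z) t v -> D2 X s t = v.
Proof.
  intros (h1 & h2 & h3); apply R3_ext; unfold D2;
    rewrite ?c1_tuple, ?c2_tuple, ?c3_tuple; now apply is_derive_unique.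
Qed.

Lemma smooth_on_D1 (U : R * R -> Prop) (X : R -> R -> R3) (s t : R) :
  smooth_on U X -> U (s, t) -> is_derive3 (fun z => X z t) s (D1 X s t).
Proof.
  intros hX h; destruct (hX s t h 1%nat) as (h1 & h2 & h3).
  split; [| split]; apply Derive_correct; [apply h1 | apply h2 | apply h3].
Qed.

Lemma smooth_on_D2 (U : R * R -> Prop) (X : R -> R -> R3) (s t : R) :
  smooth_on U X -> U (s, t) -> is_derive3 (fun z => X s z) t (D2 X s t).
Proof.
  intros hX h; destruct (hX s t h 1%nat) as (h1 & h2 & h3).
  split; [| split]; apply Derive_correct; [apply h1 | apply h2 | apply h3].
Qed.

Lemma is_derive_lin3 (f1 f2 f3 : R -> R) (s l1 l2 l3 a b c : R) :
  is_derive f1 s l1 -> is_derive f2 s l2 -> is_derive f3 s l3 ->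
  is_derive (fun z => f1 z * a + f2 z * b + f3 z * c) s (l1 * a + l2 * b + l3 * c).
Proof.
  intros h1 h2 h3; der; ring.
Qed.

Lemma is_derive3_dot (gam del : R -> R3) (s : R) (v w : R3) :
  is_derive3 gam s v -> is_derive3 del s w ->
  is_derive (fun z => dot (gam z) (del z)) s (dot v (del s) + dot (gam s) w).
Proof.
  intros (h1 & h2 & h3) (k1 & k2 & k3); unfold dot; der; ring.
Qed.

Lemma is_derive3_coords (e1 e2 e3 : R3) (gam : R -> R3) (s : R) (v : R3) :
  is_derive3 gam s v -> is_derive3 (fun z => coords e1 e2 e3 (gam z)) s (coords e1 e2 e3 v).
Proof. intros (h1 & h2 & h3); split; [| split]; simpl; now apply is_derive_lin3. Qed.

Lemma is_derive3_rigid_motion (c e1 e2 e3 : R3) (gam : R -> R3) (s : R) (v : R3) :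
  is_derive3 gam s v ->
  is_derive3 (fun z => rigid_motion c e1 e2 e3 (gam z)) s (rigid_motion zero e1 e2 e3 v).
Proof.
  intros (h1 & h2 & h3).
  assert (aux : forall a b c d, is_derive
    (fun z => d + (c1 (gam z) * a + (c2 (gam z) * b + c3 (gam z) * c))) s
    (0 + (c1 v * a + (c2 v * b + c3 v * c)))).
  { intros a b c' d; der; ring. }
  split; [| split]; apply aux.
Qed.

Lemma is_derive_eq0 (f : R -> R) (s l : R) :
  is_derive f s l -> locally s (fun z => f z = 0) -> l = 0.
Proof.
  intros hf h0; rewrite <- (is_derive_unique f s l hf), <- (Derive_const 0 s).
  now apply Derive_ext_loc.
Qed.

Lemma locally_slice1 (U : R * R -> Prop) (s t : R) :
  open U -> U (s, t) -> locally s (fun z => U (z, t)).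
Proof. intros hU h; exact (locally_2d_1d_const_y _ s t (open_locally_2d U hU s t h)). Qed.

Lemma locally_slice2 (U : R * R -> Prop) (s t : R) :
  open U -> U (s, t) -> locally t (fun z => U (s, z)).
Proof. intros hU h; exact (locally_2d_1d_const_x _ s t (open_locally_2d U hU s t h)). Qed.

(** * The normal of a surface of rotation *)

Definition rotation_chart (c e1 e2 e3 : R3) (f g : R -> R) (s t : R) : R3 :=
  rigid_motion c e1 e2 e3 (f s * cos t, f s * sin t, g s).


(** The Frenet equations of the profile curve [(f, g)] with unit normal
    [(alpha, beta)]: [m] is its signed speed and [kap] the rate of rotation of
    the normal. *)
Definition frenet_at (f g alpha beta : R -> R) (s m kap : R) : Prop :=
  is_derive f s (- m * beta s) /\ is_derive g s (m * alpha s) /\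
  is_derive alpha s (- kap * beta s) /\ is_derive beta s (kap * alpha s) /\
  alpha s * alpha s + beta s * beta s = 1 /\ m <> 0 /\ f s <> 0.

(** The profile [(f, g)] is recovered from the chart by projection on the radial
    direction at fixed [t] and on the axis, so it is differentiable. *)
Lemma rotation_chart_derivatives (c e1 e2 e3 : R3) (f g : R -> R) (U : R * R -> Prop) :
  direct_orthonormal_frame e1 e2 e3 ->
  smooth_on U (rotation_chart c e1 e2 e3 f g) ->
  forall s t, U (s, t) ->
    ex_derive f s /\ ex_derive g s /\
    D1 (rotation_chart c e1 e2 e3 f g) s t
      = rigid_motion zero e1 e2 e3 (Derive f s * cos t, Derive f s * sin t, Derive g s) /\
    D2 (rotation_chart c e1 e2 e3 f g) s t
      = rigid_motion zero e1 e2 e3 (- f s * sin t, f s * cos t, 0).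
Proof.
  intros hf hX s t hU.
  assert (hc : forall z, coords e1 e2 e3 (rotation_chart c e1 e2 e3 f g z t)
    = plus (coords e1 e2 e3 c) ((f z * cos t, f z * sin t, g z) : R3)).
  { intro z; unfold rotation_chart; rewrite (rigid_motion_coords _ _ _ _ hf).
    now apply coords_frame. }
  pose proof (is_derive3_coords e1 e2 e3 _ _ _ (smooth_on_D1 U _ s t hX hU)) as (h1 & h2 & h3).
  assert (df : ex_derive f s).
  { eexists.
    eapply is_derive_ext; [| eapply (is_derive_lin3 _ _ (fun _ => 1) s _ _ 0 (cos t) (sin t)
      (- (c1 (coords e1 e2 e3 c) * cos t + c2 (coords e1 e2 e3 c) * sin t)) h1 h2) ].
    - intro z; cbv beta; match goal with |- ?a = ?b => change (@eq R a b) end.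
      rewrite hc, c1_plus, c2_plus, c1_tuple, c2_tuple.
      transitivity (f z * (Rsqr (sin t) + Rsqr (cos t))); [unfold Rsqr; ring |].
      rewrite sin2_cos2; ring.
    - exact (is_derive_const (V := R_NormedModule) _ _). }
  assert (dg : ex_derive g s).
  { eexists.
    eapply is_derive_ext; [| eapply (is_derive_lin3 _ _ (fun _ => 1) s _ _ 0 1 0
      (- (c3 (coords e1 e2 e3 c))) h3 h2) ].
    - intro z; cbv beta; match goal with |- ?a = ?b => change (@eq R a b) end.
      rewrite hc, c3_plus, c3_tuple; ring.
    - exact (is_derive_const (V := R_NormedModule) _ _). }
  split; [| split; [| split]]; trivial.
  - apply is_derive3_D1, is_derive3_rigid_motion.
    pose proof (Derive_correct f s df); pose proof (Derive_correct g s dg).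
    split; [| split]; cbv [c1 c2 c3 fst snd]; trivial; der; ring.
  - apply is_derive3_D2, is_derive3_rigid_motion.
    split; [| split]; cbv [c1 c2 c3 fst snd]; der; ring.
Qed.

Lemma unit_orthogonal (a b x y : R) :
  a * a + b * b = 1 -> a * x + b * y = 0 ->
  x = - (a * y - b * x) * b /\ y = (a * y - b * x) * a.
Proof.
  intros h1 h2; split.
  - transitivity (x * (a * a + b * b) - a * (a * x + b * y)); [rewrite h1, h2 |]; ring.
  - transitivity (y * (a * a + b * b) - b * (a * x + b * y)); [rewrite h1, h2 |]; ring.
Qed.

(** In the moving frame (radial, angular, axial) the normal has no angular
    component, and its two other components are constant along the parallels:
    they form a unit vector orthogonal to the velocity of the profile, so along
    a parallel they could only jump between two opposite values. *)
Lemma rotation_chart_normal (S : R3 -> Prop) (nu : R3 -> R3) (c e1 e2 e3 : R3)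
    (f g : R -> R) (U : R * R -> Prop) (s0 t0 : R) :
  direct_orthonormal_frame e1 e2 e3 -> gauss_map S nu ->
  local_parameterization S (rotation_chart c e1 e2 e3 f g) U -> U (s0, t0) ->
  exists (d : R) (alpha beta : R -> R), 0 < d /\
    forall s, Rabs (s - s0) < d ->
      (exists m kap, frenet_at f g alpha beta s m kap) /\
      forall t, Rabs (t - t0) < d -> U (s, t) /\
        nu (rotation_chart c e1 e2 e3 f g s t)
          = rigid_motion zero e1 e2 e3 (alpha s * cos t, alpha s * sin t, beta s).
Proof.
  intros hf hnu hX h0.
  destruct (hnu _ _ hX) as [hs hn].
  destruct hX as (hU & hX & _ & himm & _ & _).
  pose proof (rotation_chart_derivatives c e1 e2 e3 f g U hf hX) as hD.
  set (X := rotation_chart c e1 e2 e3 f g) in *.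
  set (n := fun s t => coords e1 e2 e3 (nu (X s t))).
  set (a := fun s t => c1 (n s t) * cos t + c2 (n s t) * sin t).
  set (b := fun s t => c3 (n s t)).
  assert (trig : forall t, cos t * cos t + sin t * sin t = 1).
  { intro t; pose proof (sin2_cos2 t) as e; unfold Rsqr in e; lra. }
  assert (alg : forall s t, U (s, t) ->
    a s t * a s t + b s t * b s t = 1 /\
    a s t * Derive f s + b s t * Derive g s = 0 /\
    c1 (n s t) = a s t * cos t /\ c2 (n s t) = a s t * sin t /\
    f s <> 0 /\ a s t * Derive g s - b s t * Derive f s <> 0).
  { intros s t h.
    destruct (hD s t h) as (_ & _ & d1 & d2).
    destruct (hn s t h) as (n0 & n1 & n2).
    pose proof (himm s t h) as ni; rewrite cross_neq0 in ni.
    rewrite d1, d2, !(dot_frame _ _ _ hf) in ni.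
    rewrite <- (dot_coords _ _ _ hf) in n0.
    rewrite d1, <- (dot_coords _ _ _ hf), (coords_frame _ _ _ hf) in n1.
    rewrite d2, <- (dot_coords _ _ _ hf), (coords_frame _ _ _ hf) in n2.
    revert ni n0 n1 n2; fold (n s t); unfold a, b; vec_simpl.
    generalize (Derive f s) (Derive g s) (f s) (c1 (n s t)) (c2 (n s t)) (c3 (n s t)) (trig t).
    generalize (cos t) (sin t); clear; intros C D f' g' r x y z tr ni n0 n1 n2.
    assert (r0 : r <> 0) by (intros ->; apply ni; ring).
    assert (ang : y * C - x * D = 0).
    { apply Rmult_eq_reg_l with r; trivial; lra. }
    assert (ex : x = (x * C + y * D) * C).
    { transitivity (x * (C * C + D * D) + D * (y * C - x * D)); [rewrite tr, ang |]; ring. }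
    assert (ey : y = (x * C + y * D) * D).
    { transitivity (y * (C * C + D * D) - C * (y * C - x * D)); [rewrite tr, ang |]; ring. }
    assert (hab : (x * C + y * D) * (x * C + y * D) + z * z = 1).
    { transitivity ((x * C + y * D) * C * ((x * C + y * D) * C)
        + (x * C + y * D) * D * ((x * C + y * D) * D) + z * z).
      - transitivity ((x * C + y * D) * (x * C + y * D) * (C * C + D * D) + z * z);
          [rewrite tr |]; ring.
      - now rewrite <- ex, <- ey. }
    assert (ho : (x * C + y * D) * f' + z * g' = 0) by lra.
    repeat split; trivial.
    intro hz; apply ni.
    destruct (unit_orthogonal _ _ _ _ hab ho) as [e1 e2].
    rewrite hz in e1, e2; rewrite e1, e2; ring. }
  assert (dn1 : forall s t, U (s, t) -> exists v, is_derive3 (fun z => n z t) s v).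
  { intros s t h; eexists; apply is_derive3_coords.
    exact (smooth_on_D1 U (fun s t => nu (X s t)) s t hs h). }
  assert (dn2 : forall s t, U (s, t) -> exists v, is_derive3 (fun z => n s z) t v).
  { intros s t h; eexists; apply is_derive3_coords.
    exact (smooth_on_D2 U (fun s t => nu (X s t)) s t hs h). }
  (* Both equations for [(a, b)] have coefficients independent of [t]. *)
  assert (par : forall s t, U (s, t) ->
    is_derive (fun z => a s z) t 0 /\ is_derive (fun z => b s z) t 0).
  { intros s t h; destruct (dn2 s t h) as (v & v1 & v2 & v3).
    assert (da : exists l, is_derive (fun z => a s z) t l).
    { eexists; unfold a; der; reflexivity. }
    destruct da as [l da].
    assert (db : is_derive (fun z => b s z) t (c3 v)) by exact v3.
    destruct (alg s t h) as (e1' & e2' & _ & _ & _ & ne).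
    assert (k1 : l * a s t + a s t * l + (c3 v * b s t + b s t * c3 v) - 0 = 0).
    { refine (is_derive_eq0 (fun z => a s z * a s z + b s z * b s z - 1) t _ _ _).
      - der; ring.
      - generalize (locally_slice2 U s t hU h); apply filter_imp; intros z hz.
        destruct (alg s z hz) as (e & _); lra. }
    assert (k2 : l * Derive f s + c3 v * Derive g s = 0).
    { refine (is_derive_eq0 (fun z => a s z * Derive f s + b s z * Derive g s) t _ _ _).
      - der; ring.
      - generalize (locally_slice2 U s t hU h); apply filter_imp; intros z hz.
        now destruct (alg s z hz) as (_ & e & _). }
    assert (l = 0).
    { apply Rmult_eq_reg_r with (2 := ne).
      transitivity (Derive g s * (a s t * l + b s t * c3 v)
        - b s t * (l * Derive f s + c3 v * Derive g s)); [ring |].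
      rewrite k2; replace (a s t * l + b s t * c3 v) with 0 by lra; ring. }
    assert (c3 v = 0).
    { apply Rmult_eq_reg_r with (2 := ne).
      transitivity (a s t * (l * Derive f s + c3 v * Derive g s)
        - Derive f s * (a s t * l + b s t * c3 v)); [ring |].
      rewrite k2; replace (a s t * l + b s t * c3 v) with 0 by lra; ring. }
    subst l; split; trivial; eapply der_eq; eassumption. }
  destruct (open_locally_2d U hU s0 t0 h0) as [d hd].
  exists d, (fun s => a s t0), (fun s => b s t0); split; [apply cond_pos |].
  assert (ht0 : Rabs (t0 - t0) < d).
  { rewrite Rminus_diag, Rabs_R0; apply cond_pos. }
  intros s hs0; split.
  - pose proof (hd s t0 hs0 ht0) as h.
    destruct (alg s t0 h) as (e1' & e2' & _ & _ & f0 & ne).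
    destruct (hD s t0 h) as (df & dg & _ & _).
    destruct (dn1 s t0 h) as (v & v1 & v2 & v3).
    assert (da : exists l, is_derive (fun z => a z t0) s l).
    { eexists; unfold a; der; reflexivity. }
    destruct da as [l da].
    assert (db : is_derive (fun z => b z t0) s (c3 v)) by exact v3.
    assert (k1 : l * a s t0 + a s t0 * l + (c3 v * b s t0 + b s t0 * c3 v) - 0 = 0).
    { refine (is_derive_eq0 (fun z => a z t0 * a z t0 + b z t0 * b z t0 - 1) s _ _ _).
      - der; ring.
      - generalize (locally_slice1 U s t0 hU h); apply filter_imp; intros z hz.
        destruct (alg z t0 hz) as (e & _); lra. }
    destruct (unit_orthogonal _ _ _ _ e1' e2') as [p1 p2].
    destruct (unit_orthogonal (a s t0) (b s t0) l (c3 v) e1' ltac:(lra)) as [q1 q2].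
    exists (a s t0 * Derive g s - b s t0 * Derive f s), (a s t0 * c3 v - b s t0 * l).
    unfold frenet_at; rewrite <- p1, <- p2, <- q1, <- q2.
    split; [now apply Derive_correct |]; split; [now apply Derive_correct |].
    split; [exact da |]; split; [exact db |]; auto.
  - intros t ht; pose proof (hd s t hs0 ht) as h; split; trivial.
    rewrite <- (frame_coords _ _ _ hf (nu (X s t))); fold (n s t); f_equal.
    destruct (alg s t h) as (_ & _ & x & y & _ & _).
    assert (ea : a s t = a s t0).
    { apply (const_of_is_derive_0 (fun z => a s z) t0 d); [| exact ht].
      intros z hz; now apply (par s z (hd s z hs0 hz)). }
    assert (eb : b s t = b s t0).
    { apply (const_of_is_derive_0 (fun z => b s z) t0 d); [| exact ht].
      intros z hz; now apply (par s z (hd s z hs0 hz)). }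
    rewrite <- ea, <- eb; now apply R3_ext.
Qed.

Lemma is_derive3_ext_loc (gam del : R -> R3) (s : R) (v : R3) :
  locally s (fun z => gam z = del z) -> is_derive3 gam s v -> is_derive3 del s v.
Proof.
  intros h (h1 & h2 & h3); split; [| split];
    (eapply is_derive_ext_loc; [| eassumption]);
    generalize h; apply filter_imp; intros z e; now rewrite e.
Qed.

Lemma locally_interval (s s0 d : R) :
  Rabs (s - s0) < d -> locally s (fun z => Rabs (z - s0) < d).
Proof.
  intro h; assert (hd : 0 < d - Rabs (s - s0)) by lra.
  exists (mkposreal _ hd); intros z hz; change (Rabs (z - s) < d - Rabs (s - s0)) in hz.
  pose proof (Rabs_triang (z - s) (s - s0)).
  replace (z - s0) with (z - s + (s - s0)) by ring; lra.
Qed.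

Lemma on_sphere_origin (p n : R3) (r : R) : dot n n = 1 ->
  on_sphere (plus p (scal r n)) r zero -> dot p p + 2 * r * dot p n = 0.
Proof.
  intros hn h; unfold on_sphere in h.
  set (q := minus zero (plus p (scal r n)) : R3) in *.
  assert (hr : sqrt (dot q q) = Rabs r) by exact h.
  assert (hq : dot q q = r * r).
  { rewrite <- (sqrt_def (dot q q)) by (unfold dot; nra).
    rewrite hr, <- Rabs_mult; apply Rabs_right; nra. }
  assert (e : dot q q = dot p p + 2 * r * dot p n + r * r * dot n n).
  { unfold q; vec_simpl; ring. }
  rewrite hn in e; lra.
Qed.

(** The meridians and the parallels are lines of curvature, with Weingarten
    eigenvalues [kap / m] and [alpha / f]; hence the sum of the radii
    [m / kap + f / alpha] is [- 2 H / K]. *)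
Lemma RT_rotation_chart (S : R3 -> Prop) (nu : R3 -> R3) (c e1 e2 e3 : R3)
    (f g : R -> R) (U : R * R -> Prop) (s0 t0 : R) :
  direct_orthonormal_frame e1 e2 e3 -> RT_surface S nu ->
  local_parameterization S (rotation_chart c e1 e2 e3 f g) U -> U (s0, t0) ->
  exists (d : R) (alpha beta : R -> R), 0 < d /\
    forall s, Rabs (s - s0) < d ->
      exists m kap, frenet_at f g alpha beta s m kap /\ kap <> 0 /\ alpha s <> 0 /\
        forall t, Rabs (t - t0) < d -> U (s, t) /\
          let p := rotation_chart c e1 e2 e3 f g s t in
          nu p = rigid_motion zero e1 e2 e3 (alpha s * cos t, alpha s * sin t, beta s) /\
          dot p p + support nu p ^ 2 = support nu p * (m / kap + f s / alpha s).
Proof.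
  intros hf hRT hX h0.
  destruct hRT as [[_ hnu] hRT].
  destruct (rotation_chart_normal S nu c e1 e2 e3 f g U s0 t0 hf hnu hX h0)
    as (d & alpha & beta & hd & H).
  exists d, alpha, beta; split; trivial; intros s hs.
  destruct (H s hs) as ((m & kap & F) & Ht).
  assert (key : forall t, Rabs (t - t0) < d ->
    kap / m * (alpha s / f s) <> 0 /\
    let p := rotation_chart c e1 e2 e3 f g s t in
    dot p p + 2 * (- (1 / 2) * (kap / m + alpha s / f s) / (kap / m * (alpha s / f s))
       + support nu p / 2) * support nu p = 0).
  { intros t ht; destruct (Ht t ht) as [hU _].
    pose proof hX as (oU & smX & hS & _).
    pose proof (rotation_chart_derivatives c e1 e2 e3 f g U hf smX s t hU)
      as (_ & _ & d1 & d2).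
    destruct F as (Ff & Fg & Fa & Fb & F1 & Fm & F0).
    rewrite (is_derive_unique f _ _ Ff), (is_derive_unique g _ _ Fg) in d1.
    set (X := rotation_chart c e1 e2 e3 f g) in *.
    assert (w1 : D1 (fun x y => nu (X x y)) s t
      = plus (scal (kap / m) (D1 X s t)) (scal 0 (D2 X s t))).
    { rewrite d1, d2; apply is_derive3_D1.
      apply is_derive3_ext_loc with (fun z => rigid_motion zero e1 e2 e3
        (alpha z * cos t, alpha z * sin t, beta z)).
      { generalize (locally_interval s s0 d hs); apply filter_imp; intros z hz.
        destruct (H z hz) as (_ & k); now destruct (k t ht) as [_ ->]. }
      replace (plus _ _) with (rigid_motion zero e1 e2 e3
        (- kap * beta s * cos t, - kap * beta s * sin t, kap * alpha s)).
      2:{ apply R3_ext; vec_simpl; field; trivial. }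
      apply is_derive3_rigid_motion; split; [| split]; cbv [c1 c2 c3 fst snd];
        trivial; der; ring. }
    assert (w2 : D2 (fun x y => nu (X x y)) s t
      = plus (scal 0 (D1 X s t)) (scal (alpha s / f s) (D2 X s t))).
    { rewrite d1, d2; apply is_derive3_D2.
      apply is_derive3_ext_loc with (fun z => rigid_motion zero e1 e2 e3
        (alpha s * cos z, alpha s * sin z, beta s)).
      { generalize (locally_interval t t0 d ht); apply filter_imp; intros z hz.
        now destruct (Ht z hz) as [_ ->]. }
      replace (plus _ _) with (rigid_motion zero e1 e2 e3
        (- alpha s * sin t, alpha s * cos t, 0)).
      2:{ apply R3_ext; vec_simpl; field; trivial. }
      apply is_derive3_rigid_motion; split; [| split]; cbv [c1 c2 c3 fst snd];
        trivial; der; ring. }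
    destruct (hRT (X s t) (kap / m * (alpha s / f s) - 0 * 0)
      (- (1 / 2) * (kap / m + alpha s / f s)) (hS s t hU)) as [hK hsph].
    { exists X, U, s, t, (kap / m), 0, 0, (alpha s / f s).
      repeat (split; trivial). }
    rewrite Rmult_0_r, Rminus_0_r in hK, hsph; split; trivial.
    apply on_sphere_origin in hsph; trivial.
    now apply (proj2 (hnu X U hX) s t hU). }
  assert (nz : kap <> 0 /\ alpha s <> 0).
  { destruct (key t0) as [hK _].
    - rewrite Rminus_diag, Rabs_R0; trivial.
    - split; intro e; apply hK; rewrite e; unfold Rdiv; ring. }
  destruct nz as [k0 a0].
  exists m, kap; split; [| split; [| split]]; trivial; intros t ht.
  destruct (Ht t ht) as [hU en]; split; trivial; split; trivial.
  destruct (key t ht) as [_ e]; cbv zeta in e; revert e.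
  destruct F as (_ & _ & _ & _ & _ & m0 & f0).
  generalize (dot (rotation_chart c e1 e2 e3 f g s t) (rotation_chart c e1 e2 e3 f g s t))
    (support nu (rotation_chart c e1 e2 e3 f g s t)); intros L P e.
  transitivity (L + P ^ 2 - (L + 2 * (- (1 / 2) * (kap / m + alpha s / f s)
    / (kap / m * (alpha s / f s)) + P / 2) * P)); [rewrite e; ring | field; auto].
Qed.

(** At fixed [s], the equation of [RT_rotation_chart] is a quadratic equation
    with leading coefficient [alpha ^ 2 <> 0] in the projection [h] of [c] on the
    radial direction.  A continuous [h] with finitely many values is constant,
    and since [h'' = - h] it vanishes. *)
Lemma RT_axis_through_origin (S : R3 -> Prop) (nu : R3 -> R3) (c e1 e2 e3 : R3)
    (f g : R -> R) (U : R * R -> Prop) (s0 t0 : R) :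
  direct_orthonormal_frame e1 e2 e3 -> RT_surface S nu ->
  local_parameterization S (rotation_chart c e1 e2 e3 f g) U -> U (s0, t0) ->
  dot c e1 = 0 /\ dot c e2 = 0.
Proof.
  intros hf hRT hX h0.
  destruct (RT_rotation_chart S nu c e1 e2 e3 f g U s0 t0 hf hRT hX h0)
    as (d & alpha & beta & hd & H).
  assert (hs : Rabs (s0 - s0) < d) by (rewrite Rminus_diag, Rabs_R0; trivial).
  assert (ht : Rabs (t0 - t0) < d) by (rewrite Rminus_diag, Rabs_R0; trivial).
  destruct (H s0 hs) as (m & kap & F & _ & a0 & Ht).
  set (x := dot c e1); set (y := dot c e2); set (z := dot c e3).
  set (h := fun t => x * cos t + y * sin t).
  set (h' := fun t => y * cos t - x * sin t).
  assert (dh : forall t, is_derive h t (h' t)) by (intro t; unfold h, h'; der; ring).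
  assert (dh' : forall t, is_derive h' t (- h t)) by (intro t; unfold h, h'; der; ring).
  set (G := z + g s0).
  set (P := f s0 * alpha s0 + G * beta s0).
  set (q := m / kap + f s0 / alpha s0).
  set (B := 2 * alpha s0 * P + 2 * f s0 - alpha s0 * q).
  set (C := x * x + y * y + f s0 * f s0 + G * G + P * P - P * q).
  assert (quad : forall t, Rabs (t - t0) < d ->
    alpha s0 * alpha s0 * (h t * h t) + B * h t + C = 0).
  { intros t k; destruct (Ht t k) as (_ & en & e); cbv zeta in e; revert e.
    unfold support; rewrite en; fold q; unfold rotation_chart.
    rewrite (rigid_motion_coords _ _ _ _ hf), !(dot_frame _ _ _ hf).
    unfold coords; fold x y z; vec_simpl; fold G.
    assert (tr : cos t * cos t + sin t * sin t = 1)
      by (pose proof (sin2_cos2 t) as e; unfold Rsqr in e; lra).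
    intro e; unfold B, C, h; fold h.
    set (k0 := cos t) in *; set (k1 := sin t) in *.
    assert (eP : (x + f s0 * k0) * (alpha s0 * k0) + (y + f s0 * k1) * (alpha s0 * k1)
      + G * beta s0 = alpha s0 * (x * k0 + y * k1) + P).
    { unfold P; transitivity (alpha s0 * (x * k0 + y * k1)
        + (f s0 * alpha s0 * (k0 * k0 + k1 * k1) + G * beta s0)); [| rewrite tr]; ring. }
    rewrite eP in e.
    assert (eL : (x + f s0 * k0) * (x + f s0 * k0) + (y + f s0 * k1) * (y + f s0 * k1)
      + G * G = x * x + y * y + 2 * f s0 * (x * k0 + y * k1) + f s0 * f s0 + G * G).
    { transitivity (x * x + y * y + 2 * f s0 * (x * k0 + y * k1)
        + f s0 * f s0 * (k0 * k0 + k1 * k1) + G * G); [| rewrite tr]; ring. }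
    rewrite eL in e.
    apply Rminus_diag_eq in e; rewrite <- e; ring. }
  assert (lin : forall t, Rabs (t - t0) < d ->
    (2 * (alpha s0 * alpha s0) * h t + B) * h' t = 0).
  { intros t k.
    refine (is_derive_eq0 (fun t => alpha s0 * alpha s0 * (h t * h t) + B * h t + C) t _ _ _).
    - pose proof (dh t); der; ring.
    - generalize (locally_interval t t0 d k); apply filter_imp; exact quad. }
  assert (cst : forall t, Rabs (t - t0) < d -> h' t = 0).
  { intros t k.
    assert (e : 2 * (alpha s0 * alpha s0) * h' t * h' t
      + (2 * (alpha s0 * alpha s0) * h t + B) * - h t = 0).
    { refine (is_derive_eq0 (fun t => (2 * (alpha s0 * alpha s0) * h t + B) * h' t) t _ _ _).
      - pose proof (dh t); pose proof (dh' t); der; ring.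
      - generalize (locally_interval t t0 d k); apply filter_imp; exact lin. }
    pose proof (lin t k) as e'.
    assert (e3' : alpha s0 * alpha s0 * (h' t * h' t * h' t) = 0).
    { transitivity (/ 2 * (h' t * (2 * (alpha s0 * alpha s0) * h' t * h' t
        + (2 * (alpha s0 * alpha s0) * h t + B) * - h t)
        + h t * ((2 * (alpha s0 * alpha s0) * h t + B) * h' t))); [field |].
      rewrite e, e'; ring. }
    destruct (Req_dec (h' t) 0) as [| ne]; trivial; exfalso.
    revert e3'; repeat apply Rmult_integral_contrapositive_currified; trivial. }
  assert (w' : h' t0 = 0) by now apply cst.
  assert (w : - h t0 = 0).
  { apply (is_derive_eq0 h' t0); trivial.
    generalize (locally_interval t0 t0 d ht); apply filter_imp; exact cst. }
  assert (tr : cos t0 * cos t0 + sin t0 * sin t0 = 1)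
    by (pose proof (sin2_cos2 t0) as e; unfold Rsqr in e; lra).
  unfold h, h' in w, w'; split.
  - transitivity (x * (cos t0 * cos t0 + sin t0 * sin t0)); [rewrite tr; ring |].
    transitivity ((x * cos t0 + y * sin t0) * cos t0 - (y * cos t0 - x * sin t0) * sin t0); [ring |].
    rewrite w'; replace (x * cos t0 + y * sin t0) with 0 by lra; ring.
  - transitivity (y * (cos t0 * cos t0 + sin t0 * sin t0)); [rewrite tr; ring |].
    transitivity ((x * cos t0 + y * sin t0) * sin t0 + (y * cos t0 - x * sin t0) * cos t0); [ring |].
    rewrite w'; replace (x * cos t0 + y * sin t0) with 0 by lra; ring.
Qed.

(** * First integrals of the meridian *)

(** These are the coefficients of [ln |Psi| = slope * u + intercept], where [u]
    is the Mercator latitude of the normal; [slope] is the logarithmic derivative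
    of the support function with respect to [u].  The factor
    [Psi / |Psi|] orients the normal so that the support function is positive,
    which makes both independent of the choice of [nu]. *)
Definition slope (nu : R3 -> R3) (e3 p : R3) : R :=
  (support nu p * dot (nu p) e3 - dot p e3) / Rabs (support nu p).

(** The isothermal latitude on the unit sphere, pointing south: it is [u] for a
    point of height [z = - tanh u]. *)
Definition mercator (z : R) : R := ln ((1 - z) / (1 + z)) / 2.

Definition intercept (nu : R3 -> R3) (e3 p : R3) : R :=
  ln (Rabs (support nu p)) - slope nu e3 p
    * mercator (support nu p * dot (nu p) e3 / Rabs (support nu p)).

Lemma locally_constant_sign (h : R -> R) (s l : R) : is_derive h s l -> h s <> 0 ->
  exists d sig, 0 < d /\ sig * sig = 1 /\
    forall z, Rabs (z - s) < d -> 0 < sig * h z.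
Proof.
  intros hd h0.
  assert (hc : continuity_pt h s).
  { apply derivable_continuous_pt; exists l; now apply is_derive_Reals. }
  destruct (hc (Rabs (h s)) (Rabs_pos_lt _ h0)) as (d & hd0 & hz).
  assert (near : forall z, Rabs (z - s) < d -> Rabs (h z - h s) < Rabs (h s)).
  { intros z k; destruct (Req_dec s z) as [<- | ne].
    - rewrite Rminus_diag, Rabs_R0; now apply Rabs_pos_lt.
    - apply (hz z); repeat split; trivial. }
  destruct (Rlt_dec 0 (h s)) as [pos | neg].
  - exists d, 1; split; [trivial |]; split; [ring |]; intros z k.
    specialize (near z k); rewrite (Rabs_right (h s)) in near by lra.
    apply Rabs_def2 in near; lra.
  - exists d, (-1); split; [trivial |]; split; [ring |]; intros z k.
    specialize (near z k); rewrite (Rabs_left (h s)) in near by lra.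
    apply Rabs_def2 in near; lra.
Qed.

(** The meridian curve in the form in which [Xab] presents it: the unit normal
    is oriented so that the support function is positive, and the half-plane is
    chosen so that the radial component of the normal is positive.  The latter
    choice may turn the half-plane by [pi] and make [F] negative. *)
Definition RT_meridian_at (F g alpha beta : R -> R) (s : R) : Prop :=
  (exists m kap, frenet_at F g alpha beta s m kap /\ kap <> 0 /\
     F s * F s + g s * g s + (F s * alpha s + g s * beta s) ^ 2
       = (F s * alpha s + g s * beta s) * (m / kap + F s / alpha s)) /\
  0 < alpha s /\ 0 < F s * alpha s + g s * beta s.

Lemma frenet_at_flip (f g alpha beta : R -> R) (s m kap sig eps : R) :
  sig * sig = 1 -> eps * eps = 1 -> frenet_at f g alpha beta s m kap ->
  frenet_at (fun z => eps * f z) g (fun z => eps * (sig * alpha z))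
    (fun z => sig * beta z) s (eps * sig * m) (eps * kap).
Proof.
  intros hs he (Ff & Fg & Fa & Fb & F1 & m0 & f0).
  assert (s0 : sig <> 0) by (intros ->; lra).
  assert (e0 : eps <> 0) by (intros ->; lra).
  split; [| split; [| split; [| split; [| split; [| split]]]]].
  - der; transitivity (- eps * m * beta s * (sig * sig)); [rewrite hs |]; ring.
  - eapply der_eq; [exact Fg |].
    transitivity (m * alpha s * (sig * sig) * (eps * eps)); [rewrite hs, he |]; ring.
  - der; ring.
  - der; transitivity (sig * kap * alpha s * (eps * eps)); [rewrite he |]; ring.
  - transitivity ((eps * eps) * (sig * sig) * (alpha s * alpha s)
      + (sig * sig) * (beta s * beta s)); [ring |].
    rewrite hs, he, !Rmult_1_l; trivial.
  - repeat apply Rmult_integral_contrapositive_currified; trivial.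
  - apply Rmult_integral_contrapositive_currified; trivial.
Qed.

Lemma RT_meridian (S : R3 -> Prop) (nu : R3 -> R3) (e1 e2 e3 : R3)
    (f g : R -> R) (U : R * R -> Prop) (s0 t0 : R) :
  direct_orthonormal_frame e1 e2 e3 -> RT_surface S nu ->
  local_parameterization S (rotation_chart zero e1 e2 e3 f g) U -> U (s0, t0) ->
  exists (d : R) (F alpha beta : R -> R) (del : R), 0 < d /\
    forall s, Rabs (s - s0) < d ->
      RT_meridian_at F g alpha beta s /\
      forall t, Rabs (t - t0) < d -> U (s, t) /\
        let p := rotation_chart zero e1 e2 e3 f g s t in
        p = rigid_motion zero e1 e2 e3 (F s * cos (t + del), F s * sin (t + del), g s) /\
        dot p e3 = g s /\
        Rabs (support nu p) = F s * alpha s + g s * beta s /\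
        support nu p * dot (nu p) e3 = (F s * alpha s + g s * beta s) * beta s.
Proof.
  intros hf hRT hX h0.
  destruct (RT_rotation_chart S nu zero e1 e2 e3 f g U s0 t0 hf hRT hX h0)
    as (d & alpha & beta & hd & H).
  assert (coord3 : forall p, dot (rigid_motion zero e1 e2 e3 p) e3 = c3 p).
  { intro p; exact (f_equal c3 (coords_frame e1 e2 e3 hf p)). }
  set (P := fun s => f s * alpha s + g s * beta s).
  assert (main : forall s, Rabs (s - s0) < d -> exists m kap,
    frenet_at f g alpha beta s m kap /\ kap <> 0 /\ alpha s <> 0 /\ P s <> 0 /\
    f s * f s + g s * g s + P s ^ 2 = P s * (m / kap + f s / alpha s) /\
    forall t, Rabs (t - t0) < d -> U (s, t) /\
      let p := rotation_chart zero e1 e2 e3 f g s t in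
      dot p e3 = g s /\ dot (nu p) e3 = beta s /\ support nu p = P s).
  { intros s hs; destruct (H s hs) as (m & kap & F & k0 & a0 & Ht).
    assert (tr : forall t, cos t * cos t + sin t * sin t = 1)
      by (intro t; pose proof (sin2_cos2 t) as e; unfold Rsqr in e; lra).
    assert (hP : forall t, Rabs (t - t0) < d ->
      support nu (rotation_chart zero e1 e2 e3 f g s t) = P s).
    { intros t ht; destruct (Ht t ht) as (_ & en & _); unfold support; rewrite en.
      unfold rotation_chart; rewrite (dot_frame _ _ _ hf); vec_simpl; unfold P.
      transitivity (f s * alpha s * (cos t * cos t + sin t * sin t) + g s * beta s);
        [ring | rewrite tr; ring]. }
    assert (eq : f s * f s + g s * g s + P s ^ 2 = P s * (m / kap + f s / alpha s)).
    { assert (ht : Rabs (t0 - t0) < d) by (rewrite Rminus_diag, Rabs_R0; trivial).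
      destruct (Ht t0 ht) as (_ & _ & e); cbv zeta in e; rewrite (hP t0 ht) in e.
      rewrite <- e; unfold rotation_chart; rewrite (dot_frame _ _ _ hf); vec_simpl.
      transitivity (f s * f s * (cos t0 * cos t0 + sin t0 * sin t0) + g s * g s + P s ^ 2);
        [rewrite tr; ring | ring]. }
    exists m, kap; split; [trivial |]; split; [trivial |]; split; [trivial |].
    split; [| split; [trivial |]].
    (* If the support function vanished, so would [Lambda], and the point would be
       the origin, which lies on the axis. *)
    - intro z; rewrite z in eq; destruct F as (_ & _ & _ & _ & _ & _ & f0); apply f0; nra.
    - intros t ht; destruct (Ht t ht) as (hU & en & _).
      split; [trivial |]; split; [apply coord3 |]; split; [| now apply hP].
      rewrite en; apply coord3. }
  assert (hs0 : Rabs (s0 - s0) < d) by (rewrite Rminus_diag, Rabs_R0; trivial).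
  destruct (main s0 hs0) as (m & kap & (Ff & Fg & Fa & Fb & _) & _ & a0 & P0 & _ & _).
  assert (dP : exists l, is_derive P s0 l) by (eexists; unfold P; der; reflexivity).
  destruct dP as [lP dP].
  destruct (locally_constant_sign P s0 lP dP P0) as (d1 & sig & hd1 & hsig & pos1).
  assert (sa0 : sig * alpha s0 <> 0).
  { apply Rmult_integral_contrapositive_currified; trivial; intros ->; lra. }
  assert (dsa : exists l, is_derive (fun z => sig * alpha z) s0 l)
    by (eexists; der; reflexivity).
  destruct dsa as [la dsa].
  destruct (locally_constant_sign _ s0 la dsa sa0) as (d2 & eps & hd2 & heps & pos2).
  (* The meridian half-plane is turned by [del], which is [0] or [PI]. *)
  assert (hdel : exists del, forall t, cos (t + del) = eps * cos t /\ sin (t + del) = eps * sin t).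
  { assert (he : (eps - 1) * (eps + 1) = 0) by lra.
    apply Rmult_integral in he as [e | e].
    - exists 0; intro t; rewrite Rplus_0_r; replace eps with 1 by lra; lra.
    - exists PI; intro t; rewrite neg_cos, neg_sin; replace eps with (-1) by lra; lra. }
  destruct hdel as [del hdel].
  exists (Rmin d (Rmin d1 d2)), (fun z => eps * f z), (fun z => eps * (sig * alpha z)),
    (fun z => sig * beta z), del.
  split; [repeat apply Rmin_pos; trivial |].
  pose proof (Rmin_l d (Rmin d1 d2)); pose proof (Rmin_r d (Rmin d1 d2)).
  pose proof (Rmin_l d1 d2); pose proof (Rmin_r d1 d2).
  intros s hs.
  specialize (pos1 s ltac:(lra)); specialize (pos2 s ltac:(lra)); cbv beta in pos2.
  destruct (main s ltac:(lra)) as (m' & kap' & F & k0 & a0' & P0' & eq & Ht).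
  assert (s0' : sig <> 0) by (intros ->; lra).
  assert (e0' : eps <> 0) by (intros ->; lra).
  assert (eP : eps * f s * (eps * (sig * alpha s)) + g s * (sig * beta s) = sig * P s).
  { unfold P; transitivity (sig * (f s * alpha s * (eps * eps) + g s * beta s)); [ring |].
    rewrite heps; ring. }
  split.
  - split; [| split; [trivial | now rewrite eP]].
    exists (eps * sig * m'), (eps * kap').
    split; [now apply frenet_at_flip |].
    split; [now apply Rmult_integral_contrapositive_currified |].
    cbv beta; rewrite eP.
    transitivity (f s * f s * (eps * eps) + g s * g s + P s ^ 2 * (sig * sig)); [ring |].
    rewrite heps, hsig, Rmult_1_r, Rmult_1_r, eq.
    transitivity (P s * (sig * sig * (m' / kap') + f s / alpha s));
      [rewrite hsig; ring | field; auto].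
  - intros t ht; destruct (Ht t ltac:(lra)) as (hU & x3 & n3 & hs3).
    split; [trivial |]; cbv zeta; split; [| split; [trivial |]].
    + unfold rotation_chart; destruct (hdel t) as [-> ->]; f_equal.
      apply R3_ext; vec_simpl; trivial;
        [transitivity (f s * cos t * (eps * eps)) | transitivity (f s * sin t * (eps * eps))];
        solve [ring | rewrite heps; ring].
    + rewrite eP, hs3, n3; split.
      * transitivity (Rabs (sig * (sig * P s))).
        { f_equal; transitivity (sig * sig * P s); [rewrite hsig |]; ring. }
        rewrite Rabs_mult, (Rabs_right (sig * P s)) by lra.
        replace (Rabs sig) with 1; [ring |].
        assert (he : (sig - 1) * (sig + 1) = 0) by lra.
        apply Rmult_integral in he as [e | e].
        { replace sig with 1 by lra; now rewrite Rabs_R1. }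
        { replace sig with (-1) by lra; rewrite Rabs_left; lra. }
      * transitivity (sig * sig * (P s * beta s)); [rewrite hsig |]; ring.
Qed.

Lemma frenet_range (alpha beta : R) : 0 < alpha -> alpha * alpha + beta * beta = 1 ->
  0 < 1 - beta /\ 0 < 1 + beta.
Proof. intros; nra. Qed.

Lemma is_derive_mercator (beta : R -> R) (s l : R) : 0 < 1 - beta s -> 0 < 1 + beta s ->
  is_derive beta s l ->
  is_derive (fun z => mercator (beta z)) s (- l / ((1 - beta s) * (1 + beta s))).
Proof.
  intros h1 h2 hb.
  assert (hm : is_derive mercator (beta s) (- 1 / ((1 - beta s) * (1 + beta s)))).
  { unfold mercator; auto_derive.
    - split; [lra |]; split; trivial; now apply Rdiv_lt_0_compat.
    - field; lra. }
  eapply der_eq; [exact (is_derive_comp mercator beta s _ _ hm hb) |].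
  unfold scal; simpl; unfold mult; simpl; field; lra.
Qed.

(** Along a meridian [Psi' = kap (g alpha - F beta)], and what remains after
    multiplication by [Psi ^ 2] is [kap alpha] times the RT equation. *)
Lemma is_derive_slope (F g alpha beta : R -> R) (s : R) :
  RT_meridian_at F g alpha beta s ->
  is_derive (fun z => beta z - g z / (F z * alpha z + g z * beta z)) s 0.
Proof.
  intros ((m & kap & (Ff & Fg & Fa & Fb & F1 & m0 & f0) & k0 & eq) & a0 & P0).
  set (P := fun z => F z * alpha z + g z * beta z).
  assert (dP : is_derive P s (kap * (g s * alpha s - F s * beta s)))
    by (unfold P; der; ring).
  assert (P0' : P s <> 0) by (unfold P; lra).
  assert (dV : is_derive (fun z => / P z) s (- (kap * (g s * alpha s - F s * beta s)) / P s ^ 2))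
    by now apply (is_derive_inv P).
  change (is_derive (fun z => beta z - g z * / P z) s 0); der.
  assert (eq' : kap * alpha s * (F s * F s + g s * g s + P s ^ 2)
    = P s * (m * alpha s + kap * F s)).
  { unfold P; rewrite eq; field; split; lra. }
  transitivity ((kap * alpha s * (F s * F s + g s * g s + P s ^ 2)
    - P s * (m * alpha s + kap * F s)) / P s ^ 2); [| rewrite eq'; field; trivial].
  transitivity ((kap * alpha s * (F s * F s + g s * g s + P s ^ 2)
    - P s * (m * alpha s + kap * F s)
    + kap * F s * (P s - (F s * alpha s + g s * beta s))) / P s ^ 2).
  - field; trivial.
  - unfold P; field; exact P0'.
Qed.

(** As the slope is constant, this says that it is the derivative of [ln Psi]
    with respect to the latitude, whose own derivative is [- kap / alpha]. *)
Lemma is_derive_intercept (F g alpha beta : R -> R) (s : R) :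
  RT_meridian_at F g alpha beta s ->
  is_derive (fun z => ln (F z * alpha z + g z * beta z)
    - (beta z - g z / (F z * alpha z + g z * beta z)) * mercator (beta z)) s 0.
Proof.
  intros M; pose proof (is_derive_slope F g alpha beta s M) as dA.
  destruct M as ((m & kap & (Ff & Fg & Fa & Fb & F1 & m0 & f0) & k0 & eq) & a0 & P0).
  destruct (frenet_range (alpha s) (beta s) a0 F1) as [b1 b2].
  pose proof (is_derive_mercator beta s _ b1 b2 Fb) as du.
  set (P := fun z => F z * alpha z + g z * beta z) in *.
  assert (dP : is_derive P s (kap * (g s * alpha s - F s * beta s)))
    by (unfold P; der; ring).
  assert (dL : is_derive (fun z => ln (P z)) s (kap * (g s * alpha s - F s * beta s) * / P s)).
  { exact (is_derive_comp ln P s _ _ (is_derive_ln (P s) P0) dP). }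
  eapply der_eq.
  - apply (der_minus (fun z => ln (P z))); [exact dL |].
    apply (der_mult (fun z => beta z - g z / P z) (fun z => mercator (beta z)));
      [exact dA | exact du].
  - cbv beta.
    assert (e1 : (1 - beta s) * (1 + beta s) = alpha s * alpha s) by lra.
    rewrite e1.
    transitivity (kap / (alpha s * P s) *
      (g s * (alpha s * alpha s) - F s * alpha s * beta s + beta s * P s - g s)).
    + fold (P s); field; unfold P; lra.
    + unfold P; replace (g s * (alpha s * alpha s) - F s * alpha s * beta s
        + beta s * (F s * alpha s + g s * beta s) - g s)
        with (g s * (alpha s * alpha s + beta s * beta s - 1)) by ring.
      rewrite F1; ring.
Qed.

(** The unoriented data of the surface, evaluated on the chart, agree with the
    first integrals of the oriented meridian. *)
Lemma RT_meridian_first_integrals (S : R3 -> Prop) (nu : R3 -> R3) (e1 e2 e3 : R3)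
    (f g : R -> R) (U : R * R -> Prop) (s0 t0 : R) :
  direct_orthonormal_frame e1 e2 e3 -> RT_surface S nu ->
  local_parameterization S (rotation_chart zero e1 e2 e3 f g) U -> U (s0, t0) ->
  let X := rotation_chart zero e1 e2 e3 f g in
  let a := slope nu e3 (X s0 t0) in
  let b := intercept nu e3 (X s0 t0) in
  exists (d : R) (F alpha beta : R -> R) (del : R), 0 < d /\
    forall s, Rabs (s - s0) < d ->
      RT_meridian_at F g alpha beta s /\
      beta s - g s / (F s * alpha s + g s * beta s) = a /\
      ln (F s * alpha s + g s * beta s) - a * mercator (beta s) = b /\
      forall t, Rabs (t - t0) < d -> U (s, t) /\
        X s t = rigid_motion zero e1 e2 e3 (F s * cos (t + del), F s * sin (t + del), g s) /\
        slope nu e3 (X s t) = a /\ intercept nu e3 (X s t) = b.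
Proof.
  intros hf hRT hX h0 X a b.
  destruct (RT_meridian S nu e1 e2 e3 f g U s0 t0 hf hRT hX h0)
    as (d & F & alpha & beta & del & hd & H); fold X in H.
  exists d, F, alpha, beta, del; split; trivial.
  set (P := fun s => F s * alpha s + g s * beta s) in *.
  set (A := fun s => beta s - g s / P s).
  set (B := fun s => ln (P s) - A s * mercator (beta s)).
  assert (hs0 : Rabs (s0 - s0) < d) by (rewrite Rminus_diag, Rabs_R0; trivial).
  assert (ht0 : Rabs (t0 - t0) < d) by (rewrite Rminus_diag, Rabs_R0; trivial).
  assert (cA : forall s, Rabs (s - s0) < d -> A s = A s0).
  { apply const_of_is_derive_0; intros s hs.
    exact (is_derive_slope F g alpha beta s (proj1 (H s hs))). }
  assert (cB : forall s, Rabs (s - s0) < d -> B s = B s0).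
  { apply const_of_is_derive_0; intros s hs.
    exact (is_derive_intercept F g alpha beta s (proj1 (H s hs))). }
  assert (val : forall s t, Rabs (s - s0) < d -> Rabs (t - t0) < d ->
    slope nu e3 (X s t) = A s /\ intercept nu e3 (X s t) = B s).
  { intros s t hs ht; destruct (H s hs) as ((_ & a0 & P0) & Ht).
    destruct (Ht t ht) as (_ & _ & x3 & eP & eN); cbv zeta in x3, eP, eN.
    unfold intercept; assert (eA : slope nu e3 (X s t) = A s).
    { unfold slope; rewrite eP, eN, x3; unfold A, P; field; lra. }
    split; trivial; rewrite eA, eP, eN; fold (P s).
    replace (P s * beta s / P s) with (beta s) by (field; unfold P; lra).
    reflexivity. }
  destruct (val s0 t0 hs0 ht0) as [va vb].
  assert (ea : a = A s0) by exact va; assert (eb : b = B s0) by exact vb.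
  intros s hs; destruct (H s hs) as [M Ht].
  split; [trivial |]; fold (P s); rewrite ea, eb, <- (cA s hs).
  split; [trivial |]; split; [exact (cB s hs) |].
  intros t ht; destruct (Ht t ht) as (hU & eX & _).
  destruct (val s t hs ht) as [v1 v2].
  split; [trivial |]; split; [trivial |]; split; [exact v1 |].
  rewrite v2; exact (cB s hs).
Qed.

(** * The model surfaces *)

Definition model_radius (a b u : R) : R :=
  exp (a * u + b) / (1 + exp (2 * u)) * Mfun a u.

Definition model_height (a b u : R) : R :=
  exp (a * u + b) / (1 + exp (2 * u)) * Nfun a u.

Lemma Xab_rotation_chart (e1 e2 e3 : R3) (a b : R) :
  (fun u1 u2 => rigid_motion zero e1 e2 e3 (Xab a b u1 u2))
    = rotation_chart zero e1 e2 e3 (model_radius a b) (model_height a b).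
Proof.
  apply functional_extensionality; intro u; apply functional_extensionality; intro v.
  unfold rotation_chart; f_equal; unfold Xab, model_radius, model_height.
  apply R3_ext; vec_simpl; ring.
Qed.

Lemma smooth_Xab (e1 e2 e3 : R3) (a b : R) (U : R * R -> Prop) :
  smooth_on U (rotation_chart zero e1 e2 e3 (model_radius a b) (model_height a b)).
Proof.
  set (W := Mul (Mul (Cst (exp b)) (Exp a)) Logistic).
  set (F := Mul W (Mul (Cst (/ 2)) (Add
    (Mul (Cst a) (Add (Exp (-1)) (Mul (Cst (-1)) (Exp 3)))) (Mul (Cst 4) (Exp 1))))).
  set (G := Mul W (Add (Add (Cst 1) (Mul (Cst (-1)) (Exp 2)))
    (Mul (Cst (- a)) (Add (Cst 1) (Exp 2))))).
  assert (eF : forall u v, eval F u v = model_radius a b u).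
  { intros u v; unfold model_radius, Mfun; simpl; rewrite exp_plus.
    replace (-1 * u) with (- u) by ring; replace (1 * u) with u by ring.
    field; apply logistic_denominator. }
  assert (eG : forall u v, eval G u v = model_height a b u).
  { intros u v; unfold model_height, Nfun; simpl; rewrite exp_plus.
    field; apply logistic_denominator. }
  set (T := fun x y z => Add (Mul (Mul F Cos) (Cst x))
    (Add (Mul (Mul F Sin) (Cst y)) (Mul G (Cst z)))).
  assert (eT : forall x y z u v, eval (T x y z) u v
    = 0 + (model_radius a b u * cos v * x
        + (model_radius a b u * sin v * y + model_height a b u * z))).
  { intros; rewrite <- (eF u v), <- (eG u v); 
    transitivity (eval F u v * cos v * x + (eval F u v * sin v * y + eval G u v * z));
      [reflexivity | ring]. }
  intros u v _ n; split; [| split];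
    (eapply ex_diff_n_ext_loc;
      [apply locally_2d_forall; intros x y; apply eT | apply ex_diff_n_eval]).
Qed.

(** With [y = exp u], the unit vector [(alpha, beta)] is the stereographic
    parameterization [(2 y, 1 - y ^ 2) / (1 + y ^ 2)] of the circle. *)
Lemma meridian_is_model (F g alpha beta a b : R) :
  0 < alpha -> alpha * alpha + beta * beta = 1 -> 0 < F * alpha + g * beta ->
  beta - g / (F * alpha + g * beta) = a ->
  ln (F * alpha + g * beta) - a * mercator beta = b ->
  F = model_radius a b (mercator beta) /\ g = model_height a b (mercator beta).
Proof.
  intros a0 n1 P0 ha hb.
  set (P := F * alpha + g * beta) in *.
  set (u := mercator beta) in *.
  destruct (frenet_range alpha beta a0 n1) as [b1 b2].
  assert (eP : exp (a * u + b) = P).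
  { rewrite <- hb; replace (a * u + (ln P - a * u)) with (ln P) by ring.
    now apply exp_ln. }
  set (y := exp u).
  assert (y0 : 0 < y) by apply exp_pos.
  assert (y2 : exp (2 * u) = y * y).
  { unfold y; rewrite <- exp_plus; f_equal; ring. }
  assert (y3 : exp (3 * u) = y * y * y).
  { unfold y; rewrite <- !exp_plus; f_equal; ring. }
  assert (y1 : exp (- u) = / y) by apply exp_Ropp.
  assert (yb : y * y = (1 - beta) / (1 + beta)).
  { rewrite <- y2; unfold u, mercator.
    replace (2 * (ln ((1 - beta) / (1 + beta)) / 2)) with (ln ((1 - beta) / (1 + beta)))
      by field.
    apply exp_ln, Rdiv_lt_0_compat; trivial. }
  assert (ybeta : y * y * (1 + beta) = 1 - beta).
  { rewrite yb; field; lra. }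
  assert (eb : beta = (1 - y * y) / (1 + y * y)).
  { apply Rmult_eq_reg_r with (1 + y * y); [| nra].
    transitivity (1 - y * y); [lra | field; nra]. }
  assert (ea : alpha = 2 * y / (1 + y * y)).
  { assert (sq : alpha * alpha = (2 * y / (1 + y * y)) * (2 * y / (1 + y * y))).
    { transitivity (1 - beta * beta); [lra |]; rewrite eb; field; nra. }
    assert (0 < 2 * y / (1 + y * y)) by (apply Rdiv_lt_0_compat; nra).
    nra. }
  assert (eg : g = P * (beta - a)) by (rewrite <- ha; field; lra).
  assert (eF : F = (P - g * beta) / alpha) by (unfold P; field; lra).
  unfold model_radius, model_height, Mfun, Nfun; rewrite eP, y1, y2, y3; fold y.
  split.
  - rewrite eF, eg, ea, eb; field; repeat split; nra.
  - rewrite eg, eb; field; nra.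
Qed.

(** The Mercator latitude [u] of the normal has nonzero derivative along the
    meridian, because [kap <> 0]; so [(s, t) |-> (u s, t + del)] is an open map
    that carries the given rotation chart to [Xab]. *)
Lemma RT_rotation_chart_to_Xab (S : R3 -> Prop) (nu : R3 -> R3) (e1 e2 e3 : R3)
    (f g : R -> R) (U : R * R -> Prop) (s0 t0 : R) :
  direct_orthonormal_frame e1 e2 e3 -> RT_surface S nu ->
  local_parameterization S (rotation_chart zero e1 e2 e3 f g) U -> U (s0, t0) ->
  let p := rotation_chart zero e1 e2 e3 f g s0 t0 in
  locally_parameterized_at S
    (rotation_chart zero e1 e2 e3 (model_radius (slope nu e3 p) (intercept nu e3 p))
       (model_height (slope nu e3 p) (intercept nu e3 p))) p.
Proof.
  intros hf hRT hX h0 p.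
  destruct (RT_meridian_first_integrals S nu e1 e2 e3 f g U s0 t0 hf hRT hX h0)
    as (d & F & alpha & beta & del & hd & H).
  fold p in H; set (a := slope nu e3 p) in *; set (b := intercept nu e3 p) in *.
  set (X := rotation_chart zero e1 e2 e3 f g) in *.
  set (Y := rotation_chart zero e1 e2 e3 (model_radius a b) (model_height a b)).
  set (u := fun s => mercator (beta s)).
  assert (H' : forall s, Rabs (s - s0) < d ->
    F s = model_radius a b (u s) /\ g s = model_height a b (u s) /\ F s <> 0 /\
    (exists l, l <> 0 /\ is_derive g s l) /\ (exists l, l <> 0 /\ is_derive u s l)).
  { intros s hs; destruct (H s hs) as (M & ha & hb & _).
    destruct M as ((m & kap & (Ff & Fg & Fa & Fb & F1 & m0 & f0) & k0 & _) & a0 & P0).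
    destruct (meridian_is_model _ _ _ _ _ _ a0 F1 P0 ha hb) as [eF eg].
    destruct (frenet_range _ _ a0 F1) as [b1 b2].
    split; [trivial |]; split; [trivial |]; split; [trivial |]; split.
    - exists (m * alpha s); split; [| trivial].
      apply Rmult_integral_contrapositive_currified; lra.
    - eexists; split; [| apply is_derive_mercator; [exact b1 | exact b2 | exact Fb]].
      unfold Rdiv; apply Rmult_integral_contrapositive_currified.
      + apply Ropp_neq_0_compat, Rmult_integral_contrapositive_currified; lra.
      + apply Rinv_neq_0_compat, Rmult_integral_contrapositive_currified; lra. }
  assert (eXY : forall s t, Rabs (s - s0) < d -> Rabs (t - t0) < d ->
    Y (u s) (t + del) = X s t).
  { intros s t hs ht; destruct (H s hs) as (_ & _ & _ & Ht).
    destruct (Ht t ht) as (_ & -> & _); destruct (H' s hs) as (-> & -> & _).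
    reflexivity. }
  assert (cu : forall s, Rabs (s - s0) < d -> continuity_pt u s).
  { intros s hs; destruct (H' s hs) as (_ & _ & _ & _ & l & _ & du).
    apply derivable_continuous_pt; exists l; now apply is_derive_Reals. }
  pose proof hX as (oU & smX & hS & himm & hinj & hopen).
  set (U' := fun q : R * R => exists s t,
    Rabs (s - s0) < d /\ Rabs (t - t0) < d /\ q = (u s, t + del)).
  assert (hs0 : Rabs (s0 - s0) < d) by (rewrite Rminus_diag, Rabs_R0; trivial).
  assert (ht0 : Rabs (t0 - t0) < d) by (rewrite Rminus_diag, Rabs_R0; trivial).
  assert (bU : forall s t, Rabs (s - s0) < d -> Rabs (t - t0) < d -> U (s, t)).
  { intros s t hs ht; destruct (H s hs) as (_ & _ & _ & Ht); now apply (Ht t ht). }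
  exists U'; split.
  2:{ exists (u s0), (t0 + del); split; [now exists s0, t0 | now apply eXY]. }
  split; [| split; [| split; [| split; [| split]]]].
  - apply locally_2d_open; intros u1 u2 (s & t & hs & ht & e).
    injection e as -> ->.
    destruct (H' s hs) as (_ & _ & _ & _ & l & l0 & du).
    destruct (open_map_of_is_derive u s l (d - Rabs (s - s0)) ltac:(lra) l0 du)
      as (eta & he & hv).
    { intros z hz; apply cu.
      pose proof (Rabs_triang (z - s) (s - s0)).
      replace (z - s0) with (z - s + (s - s0)) by ring; lra. }
    assert (hm : 0 < Rmin eta (d - Rabs (t - t0))) by (apply Rmin_pos; lra).
    exists (mkposreal _ hm); simpl; intros v w hv' hw.
    pose proof (Rmin_l eta (d - Rabs (t - t0))); pose proof (Rmin_r eta (d - Rabs (t - t0))).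
    destruct (hv v ltac:(lra)) as (z & hz & <-).
    exists z, (w - del); split; [| split].
    + pose proof (Rabs_triang (z - s) (s - s0)).
      replace (z - s0) with (z - s + (s - s0)) by ring; lra.
    + pose proof (Rabs_triang (w - (t + del)) (t - t0)).
      replace (w - del - t0) with (w - (t + del) + (t - t0)) by ring; lra.
    + f_equal; ring.
  - apply smooth_Xab.
  - intros u1 u2 (s & t & hs & ht & e); injection e as -> ->.
    rewrite (eXY s t hs ht); now apply hS, bU.
  - intros u1 u2 (s & t & hs & ht & e); injection e as -> ->.
    destruct (rotation_chart_derivatives zero e1 e2 e3 _ _ (fun _ => True) hf
      (smooth_Xab e1 e2 e3 a b _) (u s) (t + del) I) as (_ & dh & d1 & d2).
    unfold Y; rewrite d1, d2; clear d1 d2; rewrite cross_neq0, !(dot_frame _ _ _ hf).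
    destruct (H' s hs) as (eF & eg & F0 & (l & l0 & dg) & (l' & _ & du)).
    (* The heights of the two charts agree, and that of the given one has nonzero
       derivative. *)
    assert (h0' : Derive (model_height a b) (u s) <> 0).
    { intro z; apply l0.
      assert (dc : is_derive (fun z => model_height a b (u z)) s (l' * 0)).
      { rewrite <- z; exact (is_derive_comp (model_height a b) u s _ _
          (Derive_correct _ _ dh) du). }
      rewrite <- (is_derive_unique g s l dg), <- (Rmult_0_r l').
      rewrite <- (is_derive_unique _ s _ dc); apply Derive_ext_loc.
      generalize (locally_interval s s0 d hs); apply filter_imp; intros z' hz'.
      now destruct (H' z' hz') as (_ & k & _). }
    rewrite <- eF; vec_simpl.
    generalize h0' F0; generalize (F s) (Derive (model_radius a b) (u s))
      (Derive (model_height a b) (u s)).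
    assert (tr : cos (t + del) * cos (t + del) + sin (t + del) * sin (t + del) = 1)
      by (pose proof (sin2_cos2 (t + del)) as e; unfold Rsqr in e; lra).
    revert tr; generalize (cos (t + del)) (sin (t + del)); clear.
    intros c k tr r x y y0 r0.
    replace (_ - _) with (r * r * (x * x * ((c * c + k * k) * (c * c + k * k))
      + y * y * (c * c + k * k))) by ring.
    rewrite tr; assert (0 < y * y) by nra; assert (0 < r * r) by nra; nra.
  - intros u1 u2 v1 v2 (s & t & hs & ht & e) (s' & t' & hs' & ht' & e').
    injection e as -> ->; injection e' as -> ->.
    rewrite (eXY s t hs ht), (eXY s' t' hs' ht'); intro E.
    destruct (hinj s t s' t' (bU _ _ hs ht) (bU _ _ hs' ht') E) as [-> ->]; auto.
  - intros V oV sub.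
    set (W := fun q : R * R => (Rabs (fst q - s0) < d /\ Rabs (snd q - t0) < d)
      /\ V (u (fst q), snd q + del)).
    destruct (hopen W) as (O & oO & hO).
    + apply locally_2d_open; unfold W; simpl; intros s t ((hs & ht) & hV).
      apply locally_2d_and.
      { apply (open_locally_2d _ (open_box s0 t0 d)); simpl; auto. }
      destruct (open_locally_2d V oV _ _ hV) as [eps he].
      destruct (continuity_2d_pt_fst u s t (cu s hs) eps) as [eta heta].
      assert (hm : 0 < Rmin eps eta) by (apply Rmin_pos; apply cond_pos).
      exists (mkposreal _ hm); simpl; intros v w hv hw.
      pose proof (Rmin_l eps eta); pose proof (Rmin_r eps eta).
      apply he.
      * apply (heta v w); lra.
      * replace (w + del - (t + del)) with (w - t) by ring; lra.
    + intros [s t] ((hs & ht) & _); now apply bU.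
    + exists O; split; trivial; intro q; rewrite (hO q); split.
      * intros (s & t & ((hs & ht) & hV) & <-); simpl in *.
        exists (u s), (t + del); split; auto.
      * intros (u1 & u2 & hV & <-).
        destruct (sub _ hV) as (s & t & hs & ht & e); injection e as -> ->.
        exists s, t; split; [| symmetry; auto]; unfold W; simpl; auto.
Qed.

(** * Points on the axis *)

Lemma triple_product_axis (e1 e2 n v : R3) :
  dot n (cross (cross e1 e2) v) = dot v e1 * dot n e2 - dot v e2 * dot n e1.
Proof. vec_simpl; ring. Qed.

Lemma jacobian_at_axis (n p q : R3) :
  dot n n = 1 -> dot n p = 0 -> dot n q = 0 ->
  c1 p * c2 n - c2 p * c1 n = 0 -> c1 q * c2 n - c2 q * c1 n = 0 ->
  cross p q <> zero -> c1 p * c2 q - c2 p * c1 q <> 0.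
Proof.
  intros n1 np nq kp kq im J; apply im; clear im; revert n1 np nq kp kq J.
  intros; cut (c2 p * c3 q - c3 p * c2 q = 0 /\ c3 p * c1 q - c1 p * c3 q = 0).
  { intros [h1 h2]; apply R3_ext; vec_simpl; trivial. }
  revert n1 np nq kp kq J; vec_simpl.
  generalize (c1 n) (c2 n) (c3 n) (c1 p) (c2 p) (c3 p) (c1 q) (c2 q) (c3 q); clear.
  intros a b c x y z u v w n1 np nq kp kq J.
  destruct (Req_dec (a * a + b * b) 0) as [r0 | r0].
  - assert (a = 0) by nra; assert (b = 0) by nra; subst a b.
    assert (c0 : c <> 0) by (intros ->; lra).
    assert (z = 0) by (apply Rmult_eq_reg_l with c; trivial; lra).
    assert (w = 0) by (apply Rmult_eq_reg_l with c; trivial; lra).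
    subst; split; ring.
  - assert (ex : (a * a + b * b) * x = - a * c * z).
    { transitivity (a * (a * x + b * y + c * z) + b * (x * b - y * a) - a * c * z);
        [ring | rewrite np, kp; ring]. }
    assert (ey : (a * a + b * b) * y = - b * c * z).
    { transitivity (b * (a * x + b * y + c * z) - a * (x * b - y * a) - b * c * z);
        [ring | rewrite np, kp; ring]. }
    assert (eu : (a * a + b * b) * u = - a * c * w).
    { transitivity (a * (a * u + b * v + c * w) + b * (u * b - v * a) - a * c * w);
        [ring | rewrite nq, kq; ring]. }
    assert (ev : (a * a + b * b) * v = - b * c * w).
    { transitivity (b * (a * u + b * v + c * w) - a * (u * b - v * a) - b * c * w);
        [ring | rewrite nq, kq; ring]. }
    split; apply Rmult_eq_reg_l with (2 := r0); rewrite Rmult_0_r.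
    + transitivity ((a * a + b * b) * y * w - z * ((a * a + b * b) * v)); [ring |].
      rewrite ey, ev; ring.
    + transitivity (z * ((a * a + b * b) * u) - (a * a + b * b) * x * w); [ring |].
      rewrite ex, eu; ring.
Qed.

Lemma smooth_on_differentiable (U : R * R -> Prop) (X : R -> R -> R3) (s t : R) (e : R3) :
  open U -> smooth_on U X -> U (s, t) ->
  differentiable_pt_lim (fun s t => dot (X s t) e) s t
    (dot (D1 X s t) e) (dot (D2 X s t) e).
Proof.
  intros oU hX h.
  assert (d1 : forall u v, U (u, v) ->
    is_derive (fun z => dot (X z v) e) u (dot (D1 X u v) e)).
  { intros u v k; destruct (smooth_on_D1 U X u v hX k) as (h1 & h2 & h3).
    now apply is_derive_lin3. }
  apply filterdiff_differentiable_pt_lim.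
  apply (is_derive_filterdiff (fun s t => dot (X s t) e) s t (fun u v => dot (D1 X u v) e)).
  - apply (proj1 (locally_2d_locally
      (fun u v => is_derive (fun z => dot (X z v) e) u (dot (D1 X u v) e)) s t)).
    apply (locally_2d_impl (fun u v => U (u, v))).
    + apply locally_2d_forall; exact d1.
    + now apply open_locally_2d.
  - destruct (smooth_on_D2 U X s t hX h) as (h1 & h2 & h3); now apply is_derive_lin3.
  - apply (proj1 (continuity_2d_pt_filterlim (fun u v => dot (D1 X u v) e) s t)).
    destruct (hX s t h 1%nat) as ((_ & _ & _ & (k1 & _) & _) & (_ & _ & _ & (k2 & _) & _)
      & (_ & _ & _ & (k3 & _) & _)).
    unfold dot; repeat apply continuity_2d_pt_plus;
      (apply continuity_2d_pt_mult; [| apply continuity_2d_pt_const]); assumption.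
Qed.

(** Near the point an invertible linear part dominates the error of the first
    order expansion. *)
Lemma isolated_fiber (x y : R -> R -> R) (s0 t0 p1 q1 p2 q2 : R) :
  differentiable_pt_lim x s0 t0 p1 q1 -> differentiable_pt_lim y s0 t0 p2 q2 ->
  p1 * q2 - p2 * q1 <> 0 ->
  locally_2d (fun s t => (s, t) <> (s0, t0) -> ~ (x s t = x s0 t0 /\ y s t = y s0 t0)) s0 t0.
Proof.
  intros hx hy hJ.
  set (J := p1 * q2 - p2 * q1) in *.
  set (C := Rabs p1 + Rabs q1 + Rabs p2 + Rabs q2 + 1).
  assert (aJ : 0 < Rabs J) by now apply Rabs_pos_lt.
  pose proof (Rabs_pos p1); pose proof (Rabs_pos q1).
  pose proof (Rabs_pos p2); pose proof (Rabs_pos q2).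
  assert (C0 : 0 < C) by (unfold C; lra).
  assert (e0 : 0 < Rabs J / (2 * C)) by (apply Rdiv_lt_0_compat; lra).
  generalize (locally_2d_and _ _ _ _ (hx (mkposreal _ e0)) (hy (mkposreal _ e0))).
  apply locally_2d_impl, locally_2d_forall; simpl.
  intros s t [ex ey] ne [zx zy]; apply ne.
  rewrite zx, Rminus_diag, Rminus_0_l, Rabs_Ropp in ex.
  rewrite zy, Rminus_diag, Rminus_0_l, Rabs_Ropp in ey.
  set (h := s - s0) in *; set (l := t - t0) in *.
  set (M := Rmax (Rabs h) (Rabs l)) in *.
  set (eps := Rabs J / (2 * C)) in *.
  assert (bh : Rabs J * Rabs h <= C * (eps * M)).
  { rewrite <- Rabs_mult.
    replace (J * h) with (q2 * (p1 * h + q1 * l) + - q1 * (p2 * h + q2 * l))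
      by (unfold J; ring).
    eapply Rle_trans; [apply Rabs_triang |]; rewrite !Rabs_mult, Rabs_Ropp.
    pose proof (Rabs_pos (p1 * h + q1 * l)); pose proof (Rabs_pos (p2 * h + q2 * l)).
    unfold C; nra. }
  assert (bl : Rabs J * Rabs l <= C * (eps * M)).
  { rewrite <- Rabs_mult.
    replace (J * l) with (p1 * (p2 * h + q2 * l) + - p2 * (p1 * h + q1 * l))
      by (unfold J; ring).
    eapply Rle_trans; [apply Rabs_triang |]; rewrite !Rabs_mult, Rabs_Ropp.
    pose proof (Rabs_pos (p1 * h + q1 * l)); pose proof (Rabs_pos (p2 * h + q2 * l)).
    unfold C; nra. }
  assert (eC : C * (eps * M) = Rabs J * (M / 2)) by (unfold eps; field; lra).
  rewrite eC in bh, bl; apply Rmult_le_reg_l in bh, bl; trivial.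
  assert (M0 : M <= M / 2) by (unfold M at 1; now apply Rmax_lub).
  pose proof (Rabs_pos h); pose proof (Rabs_pos l).
  assert (h = 0) by (destruct (Req_dec h 0) as [| z]; trivial;
    pose proof (Rabs_pos_lt _ z); lra).
  assert (l = 0) by (destruct (Req_dec l 0) as [| z]; trivial;
    pose proof (Rabs_pos_lt _ z); lra).
  f_equal; unfold h, l in *; lra.
Qed.

(** A surface whose normal is everywhere orthogonal to the rotation field
    [q |-> e3 x (q - c)] meets the axis transversally: differentiating the
    orthogonality at a point of the axis shows that [e3 x v] is tangent for each
    tangent vector [v], so that the tangent plane is orthogonal to [e3]. *)
Lemma axis_points_isolated (S : R3 -> Prop) (nu : R3 -> R3) (c e1 e2 e3 : R3)
    (X : R -> R -> R3) (U : R * R -> Prop) (s0 t0 : R) :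
  direct_orthonormal_frame e1 e2 e3 -> gauss_map S nu ->
  (forall q, S q -> dot (nu q) (cross e3 (minus q c)) = 0) ->
  local_parameterization S X U -> U (s0, t0) -> on_line c e3 (X s0 t0) ->
  locally_2d (fun s t => U (s, t) /\ ((s, t) <> (s0, t0) -> ~ on_line c e3 (X s t))) s0 t0.
Proof.
  intros hf hnu hrot hX h0 hax.
  destruct (hnu X U hX) as [smN hn].
  pose proof hX as (oU & smX & hS & himm & _ & _).
  destruct (hn s0 t0 h0) as (n0 & n1 & n2).
  assert (rot0 : cross e3 (minus (X s0 t0) c) = zero).
  { destruct hax as [r ->]; apply R3_ext; vec_simpl; ring. }
  assert (dcross : forall gam s v, is_derive3 gam s v ->
    is_derive3 (fun z => cross e3 (minus (gam z) c)) s (cross e3 v)).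
  { intros gam s v (h1 & h2 & h3).
    assert (aux : forall a b k l f1 f2 l1 l2, is_derive f1 s l1 -> is_derive f2 s l2 ->
      is_derive (fun z => a * (f1 z - k) - b * (f2 z - l)) s (a * l1 - b * l2)).
    { intros a b k l f1 f2 l1 l2 k1 k2; der; ring. }
    split; [| split].
    - exact (aux _ _ _ _ (fun z => c3 (gam z)) (fun z => c2 (gam z)) _ _ h3 h2).
    - exact (aux _ _ _ _ (fun z => c1 (gam z)) (fun z => c3 (gam z)) _ _ h1 h3).
    - exact (aux _ _ _ _ (fun z => c2 (gam z)) (fun z => c1 (gam z)) _ _ h2 h1). }
  assert (r1 : dot (nu (X s0 t0)) (cross e3 (D1 X s0 t0)) = 0).
  { pose proof (is_derive3_dot _ _ _ _ _
      (smooth_on_D1 U (fun s t => nu (X s t)) s0 t0 smN h0)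
      (dcross _ _ _ (smooth_on_D1 U X s0 t0 smX h0))) as hd; cbv beta in hd.
    apply is_derive_eq0 in hd.
    - rewrite rot0 in hd; rewrite <- hd; vec_simpl; ring.
    - generalize (locally_slice1 U s0 t0 oU h0); apply filter_imp; intros z hz; apply hrot; auto. }
  assert (r2 : dot (nu (X s0 t0)) (cross e3 (D2 X s0 t0)) = 0).
  { pose proof (is_derive3_dot _ _ _ _ _
      (smooth_on_D2 U (fun s t => nu (X s t)) s0 t0 smN h0)
      (dcross _ _ _ (smooth_on_D2 U X s0 t0 smX h0))) as hd; cbv beta in hd.
    apply is_derive_eq0 in hd.
    - rewrite rot0 in hd; rewrite <- hd; vec_simpl; ring.
    - generalize (locally_slice2 U s0 t0 oU h0); apply filter_imp; intros z hz; apply hrot; auto. }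
  assert (J : dot (D1 X s0 t0) e1 * dot (D2 X s0 t0) e2
    - dot (D1 X s0 t0) e2 * dot (D2 X s0 t0) e1 <> 0).
  { pose proof (himm s0 t0 h0) as im; rewrite cross_neq0 in im.
    rewrite <- (dot_coords _ _ _ hf (D1 X s0 t0) (D1 X s0 t0)),
      <- (dot_coords _ _ _ hf (D2 X s0 t0) (D2 X s0 t0)),
      <- (dot_coords _ _ _ hf (D1 X s0 t0) (D2 X s0 t0)), <- cross_neq0 in im.
    rewrite <- (dot_coords _ _ _ hf) in n0, n1, n2.
    assert (e3eq : e3 = cross e1 e2) by now destruct hf as (_ & _ & _ & ->).
    rewrite e3eq, triple_product_axis in r1, r2.
    exact (jacobian_at_axis (coords e1 e2 e3 (nu (X s0 t0))) _ _ n0 n1 n2 r1 r2 im). }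
  generalize (locally_2d_and _ _ _ _ (open_locally_2d U oU s0 t0 h0)
    (isolated_fiber _ _ s0 t0 _ _ _ _ (smooth_on_differentiable U X s0 t0 e1 oU smX h0)
      (smooth_on_differentiable U X s0 t0 e2 oU smX h0) J)).
  apply locally_2d_impl, locally_2d_forall; intros s t [hU iso].
  split; trivial; intros ne hl; apply (iso ne).
  rewrite (on_line_coords c e1 e2 e3 hf) in hl, hax.
  assert (lin : forall p e, dot (minus p c) e = dot p e - dot c e) by (intros; vec_simpl; ring).
  rewrite !lin in hl, hax; lra.
Qed.

(** * Constancy on a connected surface *)

Lemma chart_pullback (U : R * R -> Prop) (X : R -> R -> R3) (V : R3 -> Prop) (s t : R) :
  smooth_on U X -> U (s, t) -> open V -> V (X s t) ->
  locally_2d (fun s t => V (X s t)) s t.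
Proof.
  intros hX h oV hV; destruct (hX s t h 0%nat) as ((k1 & _) & (k2 & _) & (k3 & _)).
  destruct (oV _ hV) as [eps he].
  generalize (locally_2d_and _ _ _ _ (k1 eps) (locally_2d_and _ _ _ _ (k2 eps) (k3 eps))).
  apply locally_2d_impl, locally_2d_forall; intros u v (b1 & b2 & b3).
  apply he; split; [split |]; assumption.
Qed.

(** A punctured square is connected: two segments parallel to the axes and
    avoiding the centre lead from each of its points to a fixed point of the diagonal. *)
Lemma punctured_square_const (phi : R -> R -> R) (s0 t0 d : R) : 0 < d ->
  (forall s t, Rabs (s - s0) < d -> Rabs (t - t0) < d -> (s, t) <> (s0, t0) ->
     locally_2d (fun u v => phi u v = phi s t) s t) ->
  forall s t, Rabs (s - s0) < d -> Rabs (t - t0) < d -> (s, t) <> (s0, t0) ->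
    phi s t = phi (s0 + d / 2) (t0 + d / 2).
Proof.
  intros hd H.
  assert (between : forall a b x z, Rabs (a - x) < d -> Rabs (b - x) < d ->
    Rmin a b <= z <= Rmax a b -> Rabs (z - x) < d).
  { intros a b x z ha hb; apply Rabs_def2 in ha, hb; unfold Rmin, Rmax.
    destruct (Rle_dec a b); intro; apply Rabs_def1; lra. }
  assert (half : forall x, Rabs (x + d / 2 - x) < d).
  { intro x; apply Rabs_def1; lra. }
  assert (hor : forall a b t, Rabs (a - s0) < d -> Rabs (b - s0) < d ->
    Rabs (t - t0) < d -> t <> t0 -> phi a t = phi b t).
  { intros a b t ha hb ht ne; apply (const_of_locally_const (fun z => phi z t)).
    intros z hz; apply (locally_2d_1d_const_y (fun u v => phi u v = phi z t)), H; trivial.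
    - now apply (between a b).
    - intro e; injection e; auto. }
  assert (ver : forall s a b, Rabs (a - t0) < d -> Rabs (b - t0) < d ->
    Rabs (s - s0) < d -> s <> s0 -> phi s a = phi s b).
  { intros s a b ha hb hs ne; apply (const_of_locally_const (fun z => phi s z)).
    intros z hz; apply (locally_2d_1d_const_x (fun u v => phi u v = phi s z)), H; trivial.
    - now apply (between a b).
    - intro e; injection e; auto. }
  intros s t hs ht ne; destruct (Req_dec t t0) as [-> | nt].
  - assert (s <> s0) by (intros ->; now apply ne).
    rewrite (ver s t0 (t0 + d / 2)); auto.
    apply hor; auto; lra.
  - rewrite (hor s (s0 + d / 2)); auto.
    apply ver; auto; lra.
Qed.

(** The points of the axis are isolated, so removing them disconnects the
    surface neither globally nor locally. *)
Lemma const_off_axis (S : R3 -> Prop) (nu : R3 -> R3) (c e1 e2 e3 : R3) (Phi : R3 -> R) :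
  direct_orthonormal_frame e1 e2 e3 -> oriented_surface S nu -> connected_set S ->
  (forall q, S q -> dot (nu q) (cross e3 (minus q c)) = 0) ->
  (forall p, S p -> ~ on_line c e3 p -> exists V, open V /\ V p /\
     forall q, S q -> V q -> Phi q = Phi p) ->
  forall p q, S p -> S q -> ~ on_line c e3 p -> ~ on_line c e3 q -> Phi p = Phi q.
Proof.
  intros hf [hreg hnu] hcon hrot LC.
  (* Each point, on the axis or not, has a neighbourhood where [Phi] is constant
     off the axis. *)
  assert (near : forall p, S p -> exists V k, open V /\ V p /\
    forall q, S q -> V q -> ~ on_line c e3 q -> Phi q = k).
  { intros p hp; destruct (classic (on_line c e3 p)) as [ax | off].
    2:{ destruct (LC p hp off) as (V & oV & hV & HV); exists V, (Phi p); auto. }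
    destruct (hreg p hp) as (X & U & hX & s0 & t0 & h0 & <-).
    destruct (axis_points_isolated S nu c e1 e2 e3 X U s0 t0 hf hnu hrot hX h0 ax)
      as [d hd].
    pose proof hX as (oU & smX & hS & _ & _ & hopen).
    destruct (hopen (fun q => Rabs (fst q - s0) < d /\ Rabs (snd q - t0) < d))
      as (V & oV & hV).
    { apply open_box. }
    { intros [s t] [hs ht]; now apply hd. }
    exists V, (Phi (X (s0 + d / 2) (t0 + d / 2))); split; [trivial |]; split.
    - apply (hV (X s0 t0)); exists s0, t0; simpl.
      rewrite !Rminus_diag, Rabs_R0; pose proof (cond_pos d); auto.
    - intros q hq hVq nq.
      destruct (proj1 (hV q) (conj hq hVq)) as (s & t & [hs ht] & <-); simpl in hs, ht.
      apply (punctured_square_const (fun s t => Phi (X s t)) s0 t0 d (cond_pos d)); trivial.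
      + intros u v hu hv ne; destruct (hd u v hu hv) as [hU off].
        destruct (LC (X u v) (hS u v hU) (off ne)) as (W & oW & hW & HW).
        apply (locally_2d_impl (fun u v => U (u, v) /\ W (X u v))).
        * apply locally_2d_forall; intros x y [k1 k2]; now apply HW; [apply hS |].
        * apply locally_2d_and; [now apply open_locally_2d | now apply (chart_pullback U)].
      + intro e; injection e as -> ->; contradiction. }
  assert (dense : forall p V, S p -> open V -> V p ->
    exists q, S q /\ V q /\ ~ on_line c e3 q).
  { intros p V hp oV hV; destruct (classic (on_line c e3 p)) as [ax |]; [| now exists p].
    destruct (hreg p hp) as (X & U & hX & s0 & t0 & h0 & <-).
    pose proof hX as (oU & smX & hS & _ & _ & hopen).
    destruct (locally_2d_and _ _ _ _ (chart_pullback U X V s0 t0 smX h0 oV hV)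
      (axis_points_isolated S nu c e1 e2 e3 X U s0 t0 hf hnu hrot hX h0 ax)) as [d hd].
    pose proof (cond_pos d).
    destruct (hd (s0 + d / 2) t0) as (k1 & k2 & k3).
    - apply Rabs_def1; lra.
    - rewrite Rminus_diag, Rabs_R0; trivial.
    - exists (X (s0 + d / 2) t0); split; [now apply hS |]; split; [trivial |].
      apply k3; intro e; injection e; lra. }
  intros p q hp hq np nq; apply NNPP; intro ne.
  set (A := fun x => exists V, open V /\ V x /\
    forall y, S y -> V y -> ~ on_line c e3 y -> Phi y = Phi p).
  set (B := fun x => exists V, open V /\ V x /\
    forall y, S y -> V y -> ~ on_line c e3 y -> Phi y <> Phi p).
  destruct (hcon A B) as (x & hx & (V & oV & hV & HV) & (W & oW & hW & HW)).
  - intros x (V & oV & hV & HV); generalize (oV x hV); apply filter_imp.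
    intros y hy; now exists V.
  - intros x (V & oV & hV & HV); generalize (oV x hV); apply filter_imp.
    intros y hy; now exists V.
  - intros x hx; destruct (near x hx) as (V & k & oV & hV & HV).
    destruct (Req_dec k (Phi p)) as [e | n].
    + left; exists V; split; [trivial |]; split; [trivial |].
      intros y hy hVy ny; rewrite <- e; now apply HV.
    + right; exists V; split; [trivial |]; split; [trivial |].
      intros y hy hVy ny; now rewrite (HV y).
  - exists p; split; trivial.
    destruct (near p hp) as (V & k & oV & hV & HV); exists V.
    split; [trivial |]; split; [trivial |].
    intros y hy hVy ny; now rewrite (HV y), (HV p).
  - exists q; split; trivial.
    destruct (near q hq) as (V & k & oV & hV & HV); exists V.
    split; [trivial |]; split; [trivial |].
    intros y hy hVy ny; rewrite (HV y), <- (HV q); auto.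
  - destruct (dense x (fun y => V y /\ W y) hx) as (y & hy & [hVy hWy] & ny).
    + intros y [hVy hWy]; apply filter_and; [now apply oV | now apply oW].
    + now split.
    + now apply (HW y), HV.
Qed.

(** Off the axis, [e3 x (q - c)] is the velocity of the parallel through [q]; on
    the axis it is zero. *)
Lemma rotation_field_tangent (S : R3 -> Prop) (nu : R3 -> R3) (c e1 e2 e3 : R3) :
  direct_orthonormal_frame e1 e2 e3 -> gauss_map S nu ->
  (forall p, S p -> ~ on_line c e3 p -> exists f g,
     locally_parameterized_at S (rotation_chart c e1 e2 e3 f g) p) ->
  forall q, S q -> dot (nu q) (cross e3 (minus q c)) = 0.
Proof.
  intros hf hnu hr q hq; destruct (classic (on_line c e3 q)) as [[r ->] | off].
  { vec_simpl; ring. }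
  destruct (hr q hq off) as (f & g & U & hX & s0 & t0 & h0 & <-).
  destruct (rotation_chart_normal S nu c e1 e2 e3 f g U s0 t0 hf hnu hX h0)
    as (d & alpha & beta & hd & H).
  destruct (H s0) as [_ Ht]; [rewrite Rminus_diag, Rabs_R0; trivial |].
  destruct (Ht t0) as [_ ->]; [rewrite Rminus_diag, Rabs_R0; trivial |].
  replace (cross e3 _) with (cross (cross e1 e2)
    (rigid_motion zero e1 e2 e3 (f s0 * cos t0, f s0 * sin t0, g s0))).
  - rewrite triple_product_axis.
    pose proof (fun p => f_equal c1 (coords_frame _ _ _ hf p)) as x.
    pose proof (fun p => f_equal c2 (coords_frame _ _ _ hf p)) as y.
    unfold coords in x, y; rewrite ?c1_tuple in x.
    assert (x' : forall p, dot (rigid_motion zero e1 e2 e3 p) e1 = c1 p) by exact x.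
    assert (y' : forall p, dot (rigid_motion zero e1 e2 e3 p) e2 = c2 p) by exact y.
    rewrite !x', !y'; vec_simpl; ring.
  - destruct hf as (_ & _ & _ & <-); f_equal.
    unfold rotation_chart; apply R3_ext; vec_simpl; ring.
Qed.

Theorem theorem2p8 :
  forall (S : R3 -> Prop) (nu : R3 -> R3),
    connected_set S -> RT_surface S nu ->
    (surface_of_rotation S <->
     exists a b : R, exists e1 e2 e3 : R3,
       direct_orthonormal_frame e1 e2 e3 /\
       forall p, S p -> ~ on_line zero e3 p ->
         locally_parameterized_at S
           (fun u1 u2 => rigid_motion zero e1 e2 e3 (Xab a b u1 u2)) p).
Proof.
  intros S nu hcon hRT; split.
  2:{ intros (a & b & e1 & e2 & e3 & hf & H).
      exists zero, e1, e2, e3; split; trivial; intros p hp off.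
      exists (model_radius a b), (model_height a b).
      specialize (H p hp off); rewrite Xab_rotation_chart in H; exact H. }
  intros (c & e1 & e2 & e3 & hf & hr).
  pose proof hRT as [[hreg hnu] _].
  pose proof (rotation_field_tangent S nu c e1 e2 e3 hf hnu hr) as hrot.
  destruct (classic (exists p, S p /\ ~ on_line c e3 p)) as [(p1 & hp1 & off1) | none].
  (* A surface contained in the axis is empty, since the axis contains only
     isolated points of it. *)
  2:{ exists 0, 0, e1, e2, e3; split; trivial; intros p hp _; exfalso; apply none.
      destruct (classic (on_line c e3 p)) as [ax |]; [| now exists p].
      destruct (hreg p hp) as (X & U & hX & s0 & t0 & h0 & <-).
      destruct (axis_points_isolated S nu c e1 e2 e3 X U s0 t0 hf hnu hrot hX h0 ax)
        as [d hd].
      pose proof (cond_pos d).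
      destruct (hd (s0 + d / 2) t0) as [hU off].
      - apply Rabs_def1; lra.
      - rewrite Rminus_diag, Rabs_R0; trivial.
      - exists (X (s0 + d / 2) t0); split; [now apply hX |].
        apply off; intro e; injection e; lra. }
  assert (hc : dot c e1 = 0 /\ dot c e2 = 0).
  { destruct (hr p1 hp1 off1) as (f & g & U & hX & s0 & t0 & h0 & _).
    exact (RT_axis_through_origin S nu c e1 e2 e3 f g U s0 t0 hf hRT hX h0). }
  assert (hline : forall p, on_line zero e3 p <-> on_line c e3 p).
  { destruct hc as [c1' c2']; intro p; rewrite !(on_line_coords _ e1 e2 e3 hf).
    assert (lin : forall q e, dot (minus p q) e = dot p e - dot q e)
      by (intros; vec_simpl; ring).
    assert (z : forall e, dot zero e = 0) by (intros; vec_simpl; ring).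
    rewrite !lin, !z, c1', c2'; tauto. }
  (* The axis passes through the origin, so [c] only shifts the height. *)
  assert (hr0 : forall p, S p -> ~ on_line zero e3 p -> exists f g,
    locally_parameterized_at S (rotation_chart zero e1 e2 e3 f g) p).
  { intros p hp off; destruct (hr p hp) as (f & g & H); [now rewrite <- hline |].
    exists f, (fun s => dot c e3 + g s).
    replace (rotation_chart zero e1 e2 e3 f (fun s => dot c e3 + g s))
      with (rotation_chart c e1 e2 e3 f g); trivial.
    apply functional_extensionality; intro s; apply functional_extensionality; intro t.
    unfold rotation_chart; rewrite (rigid_motion_coords c _ _ _ hf); f_equal.
    destruct hc as [c1' c2']; unfold coords; rewrite c1', c2'.
    apply R3_ext; vec_simpl; ring. }
  pose proof (rotation_field_tangent S nu zero e1 e2 e3 hf hnu hr0) as hrot0.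
  assert (LC : forall p, S p -> ~ on_line zero e3 p -> exists V, open V /\ V p /\
    forall q, S q -> V q ->
      slope nu e3 q = slope nu e3 p /\ intercept nu e3 q = intercept nu e3 p).
  { intros p hp off; destruct (hr0 p hp off) as (f & g & U & hX & s0 & t0 & h0 & <-).
    destruct (RT_meridian_first_integrals S nu e1 e2 e3 f g U s0 t0 hf hRT hX h0)
      as (d & F & alpha & beta & del & hd & H).
    pose proof hX as (_ & _ & _ & _ & _ & hopen).
    destruct (hopen (fun q => Rabs (fst q - s0) < d /\ Rabs (snd q - t0) < d))
      as (V & oV & hV).
    { apply open_box. }
    { intros [s t] [hs ht]; destruct (H s hs) as (_ & _ & _ & Ht); now apply (Ht t ht). }
    exists V; split; [trivial |]; split.
    - apply (hV (rotation_chart zero e1 e2 e3 f g s0 t0)); exists s0, t0; simpl.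
      rewrite !Rminus_diag, Rabs_R0; auto.
    - intros q hq hVq.
      destruct (proj1 (hV q) (conj hq hVq)) as (s & t & [hs ht] & <-); simpl in hs, ht.
      destruct (H s hs) as (_ & _ & _ & Ht); now destruct (Ht t ht) as (_ & _ & k). }
  assert (off1' : ~ on_line zero e3 p1) by now rewrite hline.
  exists (slope nu e3 p1), (intercept nu e3 p1), e1, e2, e3; split; trivial.
  intros p hp off.
  rewrite Xab_rotation_chart.
  rewrite (const_off_axis S nu zero e1 e2 e3 (slope nu e3) hf (conj hreg hnu) hcon hrot0)
    with (p := p1) (q := p); trivial.
  2:{ intros q hq nq; destruct (LC q hq nq) as (V & oV & hV & HV); exists V.
      split; [trivial |]; split; [trivial |]; intros; now apply HV. }
  rewrite (const_off_axis S nu zero e1 e2 e3 (intercept nu e3) hf (conj hreg hnu) hcon hrot0)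
    with (p := p1) (q := p); trivial.
  2:{ intros q hq nq; destruct (LC q hq nq) as (V & oV & hV & HV); exists V.
      split; [trivial |]; split; [trivial |]; intros; now apply HV. }
  destruct (hr0 p hp off) as (f & g & U & hX & s0 & t0 & h0 & <-).
  exact (RT_rotation_chart_to_Xab S nu e1 e2 e3 f g U s0 t0 hf hRT hX h0).
Qed.
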